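(* Consider the SDP pair and one-step ADMM in the context, with $\mathcal A$ surjective and nonempty KKT set, and let $Z_\star=X_\star-\sigma S_\star$ be the limit of $Z^{(k)}$, where $(X_\star,y_\star,S_\star)$ is a KKT point (strict complementarity is not assumed). Suppose primal nondegeneracy $\mathcal N_{X_\star}\cap\mathcal R(\mathcal A^* )=\{0\}$ and dual nondegeneracy $\mathcal N_{S_\star}\cap\mathcal N(\mathcal A)=\{0\}$ hold. Define $\rho_{\mathrm{ND}}:=\sup_{\|H\|_F=1}\|\widetilde{\mathcal M}(H)\|_F$. Then $\rho_{\mathrm{ND}}<1$, and for any $\rho\in(\rho_{\mathrm{ND}},1)$ there exists $\bar k_{\mathrm{ND}}\in\mathbb N$ such that $\|Z^{(k+1)}-Z_\star\|_F\le\rho\|Z^{(k)}-Z_\star\|_F$ for all integers $k\ge\bar k_{\mathrm{ND}}$.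
   Context: $\mathbb S^n$: real symmetric matrices, trace inner product, Frobenius norm; $\Pi_{\mathbb S^p_+}$ the projection onto the $p\times p$ PSD cone. Data $C,A_i\in\mathbb S^n$, $b\in\mathbb R^m$, $\mathcal AX=(\langle A_i,X\rangle)_i$, $\mathcal A^*y=\sum y_iA_i$, $\mathcal R(\mathcal A^* )$ its range, $\mathcal N(\mathcal A)$ null space. Primal: min $\langle C,X\rangle$ s.t. $\mathcal AX=b$, $X\succeq0$; dual: max $b^\top y$ s.t. $\mathcal A^*y+S=C$, $S\succeq0$; KKT point: primal/dual feasible with $\langle X,S\rangle=0$. $\mathcal P=\mathcal A^*(\mathcal A\mathcal A^* )^{-1}\mathcal A$, $\mathcal P^\perp=\mathrm{Id}-\mathcal P$. For $\sigma>0$, one-step ADMM: $Z^{(k+1)}=\mathcal P(-2\Pi_{\mathbb S^n_+}(Z^{(k)})+Z^{(k)})+\Pi_{\mathbb S^n_+}(Z^{(k)})+\mathcal A^*(\mathcal A\mathcal A^* )^{-1}b+\sigma\mathcal PC-\sigma C$. Let $r=\operatorname{rank}X_\star$, $s=\operatorname{rank}S_\star$ ($r+s\le n$); there is an orthogonal $Q_\star$ with $Z_\star=Q_\star\operatorname{diag}(\lambda_1,\dots,\lambda_n)Q_\star^\top$, $\lambda_1\ge\dots\ge\lambda_r>0=\lambda_{r+1}=\dots=\lambda_{n-s}>\lambda_{n-s+1}\ge\dots\ge\lambda_n$, $X_\star=Q_\star\operatorname{diag}(\lambda_1,..,\lambda_r,0,..,0)Q_\star^\top$, $\sigma S_\star=Q_\star\operatorname{diag}(0,..,0,-\lambda_{n-s+1},..,-\lambda_n)Q_\star^\top$.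 Index sets $\alpha=\{1,..,r\}$, $\beta=\{r+1,..,n-s\}$, $\gamma=\{n-s+1,..,n\}$; for $H\in\mathbb S^n$ write $\hat H=Q_\star^\top HQ_\star$ with blocks $\hat H_{\alpha\alpha},\hat H_{\beta\alpha},\hat H_{\gamma\alpha},\hat H_{\beta\beta},\hat H_{\gamma\beta},\hat H_{\gamma\gamma}$. Let $\tilde\Theta\in\mathbb R^{s\times r}$, $\tilde\Theta_{ij}=\lambda_j/(\lambda_j-\lambda_{n-s+i})$. Define $\widetilde{\mathcal D}(H)=Q_\star\begin{pmatrix}\hat H_{\alpha\alpha}&\hat H_{\beta\alpha}^\top&\tilde\Theta^\top\circ\hat H_{\gamma\alpha}^\top\\ \hat H_{\beta\alpha}&\Pi_{\mathbb S^{|\beta|}_+}(\hat H_{\beta\beta})&0\\ \tilde\Theta\circ\hat H_{\gamma\alpha}&0&0\end{pmatrix}Q_\star^\top$ ($\circ$ Hadamard product), $\widetilde{\mathcal D}^\perp(H)=H-\widetilde{\mathcal D}(H)$, $\widetilde{\mathcal M}(H)=\mathcal P\widetilde{\mathcal D}^\perp(H)+\mathcal P^\perp\widetilde{\mathcal D}(H)$. $\mathcal N_{X_\star}=\{Q_\star\begin{pmatrix}0&0\\0&D\end{pmatrix}Q_\star^\top:D\in\mathbb S^{n-r}\}$, $\mathcal N_{S_\star}=\{Q_\star\begin{pmatrix}A&0\\0&0\end{pmatrix}Q_\star^\top:A\in\mathbb S^{n-s}\}$. *)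

(* Defs.v *)
From mathcomp Require Import all_boot all_order all_algebra.
From mathcomp Require Import boolp classical_sets reals.
Set Implicit Arguments. Unset Strict Implicit. Unset Printing Implicit Defensive.
Import Order.TTheory GRing.Theory Num.Theory.
Local Open Scope ring_scope.

Section SDP.
Variable R : realType.

Definition mxinner (p : nat) (X Y : 'M[R]_p) : R :=
  \sum_(i < p) \sum_(j < p) X i j * Y i j.
Definition frob (p : nat) (X : 'M[R]_p) : R := Num.sqrt (mxinner X X).

Definition symmx (p : nat) (X : 'M[R]_p) : Prop := X^T = X.

Definition psdmx (p : nat) (X : 'M[R]_p) : Prop :=
  symmx X /\ forall v : 'cV[R]_p, 0 <= (v^T *m X *m v) 0 0.

Definition psd_proj (p : nat) (Z : 'M[R]_p) : 'M[R]_p :=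
  xget 0 [set P : 'M[R]_p | psdmx P /\
          forall Y : 'M[R]_p, psdmx Y -> frob (Z - P) <= frob (Z - Y)].

Definition Aop (n m : nat) (A : 'I_m -> 'M[R]_n) (X : 'M[R]_n) : 'cV[R]_m :=
  \col_i mxinner (A i) X.
Definition Aadj (n m : nat) (A : 'I_m -> 'M[R]_n) (y : 'cV[R]_m) : 'M[R]_n :=
  \sum_(i < m) y i 0 *: A i.
Definition AAadj (n m : nat) (A : 'I_m -> 'M[R]_n) : 'M[R]_m :=
  \matrix_(i, j) mxinner (A i) (A j).
Definition Pop (n m : nat) (A : 'I_m -> 'M[R]_n) (X : 'M[R]_n) : 'M[R]_n :=
  Aadj A (invmx (AAadj A) *m Aop A X).
Definition Pperp (n m : nat) (A : 'I_m -> 'M[R]_n) (X : 'M[R]_n) : 'M[R]_n :=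
  X - Pop A X.

Definition admm_step (n m : nat) (A : 'I_m -> 'M[R]_n) (b : 'cV[R]_m)
  (C : 'M[R]_n) (sigma : R) (Z : 'M[R]_n) : 'M[R]_n :=
  Pop A (- (2%:R *: psd_proj Z) + Z) + psd_proj Z
  + Aadj A (invmx (AAadj A) *m b) + sigma *: Pop A C - sigma *: C.

Definition KKT (n m : nat) (A : 'I_m -> 'M[R]_n) (b : 'cV[R]_m) (C : 'M[R]_n)
  (X : 'M[R]_n) (y : 'cV[R]_m) (S : 'M[R]_n) : Prop :=
  [/\ psdmx X, Aop A X = b, psdmx S, Aadj A y + S = C & mxinner X S = 0].

Definition npos (n : nat) (lam : 'I_n -> R) : nat := #|[set i | 0 < lam i]|.
Definition nneg (n : nat) (lam : 'I_n -> R) : nat := #|[set i | lam i < 0]|.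

Definition mxget (p : nat) (M : 'M[R]_p) (a c : nat) : R :=
  match (insub a : option 'I_p), (insub c : option 'I_p) with
  | Some i, Some j => M i j
  | _, _ => 0
  end.

Definition hatmx (n : nat) (Q H : 'M[R]_n) : 'M[R]_n := Q^T *m H *m Q.

Definition beta_block (n : nat) (lam : 'I_n -> R) (Q H : 'M[R]_n)
  : 'M[R]_(n - npos lam - nneg lam) :=
  \matrix_(k, l) mxget (hatmx Q H) (npos lam + k) (npos lam + l).

Definition Dtil (n : nat) (lam : 'I_n -> R) (Q H : 'M[R]_n) : 'M[R]_n :=
  let r := npos lam in
  let s := nneg lam in
  let Hh := hatmx Q H in
  let inA (i : 'I_n) := (i < r)%N in
  let inB (i : 'I_n) := (r <= i)%N && (i < n - s)%N in
  let inG (i : 'I_n) := (n - s <= i)%N in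
  Q *m (\matrix_(i, j)
     if inA i && inA j then Hh i j
     else if inB i && inA j then Hh i j
     else if inA i && inB j then Hh j i
     else if inB i && inB j then
       mxget (psd_proj (beta_block lam Q H)) (i - r) (j - r)
     else if inG i && inA j then
       lam j / (lam j - lam i) * Hh i j
     else if inA i && inG j then
       lam i / (lam i - lam j) * Hh j i
     else 0) *m Q^T.

Definition Dtil_perp (n : nat) (lam : 'I_n -> R) (Q H : 'M[R]_n) : 'M[R]_n :=
  H - Dtil lam Q H.

Definition Mtil (n m : nat) (A : 'I_m -> 'M[R]_n) (lam : 'I_n -> R)
  (Q H : 'M[R]_n) : 'M[R]_n :=
  Pop A (Dtil_perp lam Q H) + Pperp A (Dtil lam Q H).

Definition rho_ND (n m : nat) (A : 'I_m -> 'M[R]_n) (lam : 'I_n -> R)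
  (Q : 'M[R]_n) : R :=
  sup [set t : R | exists H : 'M[R]_n,
         [/\ symmx H, frob H = 1 & t = frob (Mtil A lam Q H)]].

Definition NX (n : nat) (lam : 'I_n -> R) (Q W : 'M[R]_n) : Prop :=
  symmx W /\ exists D : 'M[R]_(n - npos lam), symmx D /\
    hatmx Q W = \matrix_(i, j)
      (if (npos lam <= i)%N && (npos lam <= j)%N
       then mxget D (i - npos lam) (j - npos lam) else 0).

Definition NS (n : nat) (lam : 'I_n -> R) (Q W : 'M[R]_n) : Prop :=
  symmx W /\ exists D : 'M[R]_(n - nneg lam), symmx D /\
    hatmx Q W = \matrix_(i, j)
      (if (i < n - nneg lam)%N && (j < n - nneg lam)%N
       then mxget D i j else 0).

End SDP.

(* Main.v *)
(** Write [Z* + H] in the eigenbasis of [Z*] and let [K] be the first-order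
    variation of the eigenbasis restricted to the lower sign blocks.  Since
    [K^3 = 0], the frames [G = 1 + K] and [F = 1 - K^T + (K^T)^2] are exactly dual
    ([F^T G = 1]), so for orthogonal positive semidefinite [D1], [D2] the matrices
    [G D1 G^T] and [F D2 F^T] form an exact Moreau pair.  A suitable choice makes
    their difference [Z* + H + O(|H|^2)], and nonexpansiveness of the projection
    gives [Pi (Z* + H) = X* + Dtil H + O(|H|^2)] without any eigenvalue
    perturbation theory.  Hence [Z_{k+1} - Z* = Mtil (Z_k - Z* ) + O(|Z_k - Z*|^2)].
    Next, [|Mtil H|^2 = |H|^2 - 2 <D, D'> - |P' D'|^2 - |P D|^2] with
    [D = Dtil H], [D' = H - D] and [P' = 1 - P].  If the norm is preserved, then
    [<D, D'> = 0] kills the alpha-gamma block of [H], so [D'] lies in [N_X] and in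
    the range of the adjoint, [D] lies in [N_S] and in the kernel of [A], and
    nondegeneracy gives [H = 0]; compactness of the unit sphere concludes. *)
Require Import Defs.
From mathcomp Require Import all_boot all_order all_algebra.
From mathcomp Require Import boolp classical_sets reals topology normedtype derive.
From mathcomp Require Import zify ring lra.
Import Order.TTheory GRing.Theory Num.Theory.
Set Implicit Arguments. Unset Strict Implicit. Unset Printing Implicit Defensive.
Local Open Scope ring_scope.

(** * Trace inner product and Frobenius norm *)

Section InnerProduct.
Context {R : realType} {p : nat}.
Implicit Types (X Y Z : 'M[R]_p) (a c : R).

Lemma mxinnerE X Y : mxinner X Y = \tr (X^T *m Y).
Proof.
rewrite /mxinner /mxtrace exchange_big /=; apply: eq_bigr => j _.
by rewrite mxE; apply: eq_bigr => i _; rewrite mxE.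
Qed.

Lemma mxinnerC X Y : mxinner X Y = mxinner Y X.
Proof. by apply: eq_bigr => i _; apply: eq_bigr => j _; rewrite mulrC. Qed.

Lemma mxinnerDl X Y Z : mxinner (X + Y) Z = mxinner X Z + mxinner Y Z.
Proof. by rewrite !mxinnerE linearD mulmxDl mxtraceD. Qed.

Lemma mxinnerZl a X Y : mxinner (a *: X) Y = a * mxinner X Y.
Proof. by rewrite !mxinnerE linearZ -scalemxAl mxtraceZ. Qed.

Lemma mxinnerNl X Y : mxinner (- X) Y = - mxinner X Y.
Proof. by rewrite -scaleN1r mxinnerZl mulN1r. Qed.

Lemma mxinnerBl X Y Z : mxinner (X - Y) Z = mxinner X Z - mxinner Y Z.
Proof. by rewrite mxinnerDl mxinnerNl. Qed.

Lemma mxinnerDr X Y Z : mxinner X (Y + Z) = mxinner X Y + mxinner X Z.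
Proof. by rewrite mxinnerC mxinnerDl !(mxinnerC _ X). Qed.

Lemma mxinnerZr a X Y : mxinner X (a *: Y) = a * mxinner X Y.
Proof. by rewrite mxinnerC mxinnerZl (mxinnerC _ X). Qed.

Lemma mxinnerNr X Y : mxinner X (- Y) = - mxinner X Y.
Proof. by rewrite mxinnerC mxinnerNl (mxinnerC _ X). Qed.

Lemma mxinnerBr X Y Z : mxinner X (Y - Z) = mxinner X Y - mxinner X Z.
Proof. by rewrite mxinnerDr mxinnerNr. Qed.

Lemma mxinner0l X : mxinner 0 X = 0.
Proof. by rewrite -(scale0r 0) mxinnerZl mul0r. Qed.

Lemma mxinner0r X : mxinner X 0 = 0.
Proof. by rewrite mxinnerC mxinner0l. Qed.

Lemma mxinner_suml (I : finType) (F : I -> 'M[R]_p) Y :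
  mxinner (\sum_i F i) Y = \sum_i mxinner (F i) Y.
Proof.
by rewrite (big_morph (fun X => mxinner X Y) (fun _ _ => mxinnerDl _ _ _) (mxinner0l Y)).
Qed.

Lemma mxinner_ge0 X : 0 <= mxinner X X.
Proof. by apply: sumr_ge0 => i _; apply: sumr_ge0 => j _; rewrite -expr2 sqr_ge0. Qed.

Lemma frob_ge0 X : 0 <= frob X. Proof. exact: sqrtr_ge0. Qed.

Lemma frob_sqr X : frob X ^+ 2 = mxinner X X.
Proof. by rewrite sqr_sqrtr // mxinner_ge0. Qed.

Lemma frob_sqr_sum X : frob X ^+ 2 = \sum_(i < p) \sum_(j < p) X i j ^+ 2.
Proof. by rewrite frob_sqr; apply: eq_bigr => i _; apply: eq_bigr => j _. Qed.

Lemma frob_leP X a : 0 <= a -> (frob X <= a) = (mxinner X X <= a ^+ 2).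
Proof. by move=> a0; rewrite -frob_sqr ler_sqr // ?nnegrE ?frob_ge0. Qed.

Lemma mxinner_eq0 X : mxinner X X = 0 -> X = 0.
Proof.
move=> /eqP; rewrite psumr_eq0; last first.
  by move=> i _; apply: sumr_ge0 => j _; rewrite -expr2 sqr_ge0.
move=> /allP h; apply/matrixP => i j; rewrite mxE.
have /h/= := mem_index_enum i.
rewrite psumr_eq0; last by move=> k _; rewrite -expr2 sqr_ge0.
by move=> /allP /(_ j (mem_index_enum j)) /=; rewrite mulf_eq0 orbb => /eqP.
Qed.

Lemma frob_eq0 X : frob X = 0 -> X = 0.
Proof. by move=> h; apply: mxinner_eq0; rewrite -frob_sqr h expr0n. Qed.

Lemma frob0 : frob (0 : 'M[R]_p) = 0.
Proof. by rewrite /frob mxinner0l sqrtr0. Qed.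

Lemma frobZ a X : frob (a *: X) = `|a| * frob X.
Proof.
rewrite /frob mxinnerZl mxinnerZr mulrA -expr2.
by rewrite sqrtrM ?sqr_ge0 // sqrtr_sqr.
Qed.

Lemma frobN X : frob (- X) = frob X.
Proof. by rewrite -scaleN1r frobZ normrN1 mul1r. Qed.

Lemma frobC X Y : frob (X - Y) = frob (Y - X).
Proof. by rewrite -frobN opprB. Qed.

(** Cauchy-Schwarz: with [x], [y] the norms and [t] the inner product, the squared norm of
    [y X - x Y] is [2 x y (x y - t)]. Null norms are set apart so that [x y] can be cancelled. *)
Lemma mxinner_le_frob X Y : mxinner X Y <= frob X * frob Y.
Proof.
have [Y0|Ypos] := eqVneq (frob Y) 0.
  by rewrite (frob_eq0 Y0) mxinner0r frob0 mulr0.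
have [X0|Xpos] := eqVneq (frob X) 0.
  by rewrite (frob_eq0 X0) mxinner0l frob0 mul0r.
have xp : 0 < frob X by rewrite lt_def Xpos frob_ge0.
have yp : 0 < frob Y by rewrite lt_def Ypos frob_ge0.
have := mxinner_ge0 (frob Y *: X - frob X *: Y).
rewrite mxinnerBl !mxinnerBr !mxinnerZl !mxinnerZr -!frob_sqr (mxinnerC Y X).
set x := frob X in xp *; set y := frob Y in yp *; set t := mxinner X Y.
rewrite (_ : _ - _ = 2 * (x * y) * (x * y - t)); last by ring.
by rewrite pmulr_rge0 ?subr_ge0 // !mulr_gt0.
Qed.

Lemma normr_mxinner_le X Y : `|mxinner X Y| <= frob X * frob Y.
Proof.
by rewrite ler_norml lerNl -mxinnerNl -{1}(frobN X) !mxinner_le_frob.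
Qed.

Lemma frobD X Y : frob (X + Y) <= frob X + frob Y.
Proof.
rewrite frob_leP ?addr_ge0 ?frob_ge0 // mxinnerDl !mxinnerDr (mxinnerC Y X) -!frob_sqr.
have := mxinner_le_frob X Y; lra.
Qed.

Lemma frobB X Y : frob (X - Y) <= frob X + frob Y.
Proof. by rewrite -(frobN Y) frobD. Qed.

Lemma frob_tr X : frob X^T = frob X.
Proof.
congr Num.sqrt; rewrite /mxinner exchange_big /=.
by apply: eq_bigr => i _; apply: eq_bigr => j _; rewrite !mxE.
Qed.

Lemma sum_mul_sqr_le (I : finType) (f g : I -> R) :
  (\sum_i f i * g i) ^+ 2 <= (\sum_i f i ^+ 2) * (\sum_i g i ^+ 2).
Proof.
set a := \sum_i f i ^+ 2; set b := \sum_i g i ^+ 2; set c := \sum_i _ * _.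
have b0 : 0 <= b by apply: sumr_ge0 => i _; rewrite sqr_ge0.
have h x y : 0 <= x ^+ 2 * a - 2 * (x * y) * c + y ^+ 2 * b.
  rewrite -[leRHS](_ : \sum_i (x * f i - y * g i) ^+ 2 = _).
    by apply: sumr_ge0 => i _; rewrite sqr_ge0.
  rewrite !mulr_sumr -sumrB -big_split /=; apply: eq_bigr => i _; ring.
have [b_eq0|bn0] := eqVneq b 0.
  have gz i : g i = 0.
    move/eqP: b_eq0; rewrite psumr_eq0 => [/allP/(_ i (mem_index_enum i))|j _].
      by rewrite /= sqrf_eq0 => /eqP.
    exact: sqr_ge0.
  by rewrite /c big1 ?expr0n ?b_eq0 ?mulr0 // => i _; rewrite gz mulr0.
have bp : 0 < b by rewrite lt_def bn0.
(* At [(b, c)] the nonnegative form factors through [b], which is now positive. *)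
have := h b c; rewrite (_ : _ + _ = b * (a * b - c ^+ 2)); last by ring.
by rewrite pmulr_rge0 // subr_ge0.
Qed.

(** Cauchy-Schwarz for a row of [X] against a column of [Y] bounds each entry of the product. *)
Lemma frobM X Y : frob (X *m Y) <= frob X * frob Y.
Proof.
rewrite -(@ler_pXn2r _ 2) ?nnegrE ?mulr_ge0 ?frob_ge0 // exprMn !frob_sqr_sum.
rewrite [X in _ <= _ * X]exchange_big /= mulr_suml; apply: ler_sum => i _.
rewrite mulr_sumr; apply: ler_sum => j _; rewrite mxE.
exact: sum_mul_sqr_le.
Qed.

Lemma frob_le_entries X a :
  0 <= a -> (forall i j, `|X i j| <= a) -> frob X <= p%:R * a.
Proof.
move=> a0 h; rewrite -(@ler_pXn2r _ 2) ?nnegrE ?mulr_ge0 ?frob_ge0 //.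
rewrite frob_sqr_sum.
apply: (@le_trans _ _ (\sum_(i < p) \sum_(j < p) a ^+ 2)).
  apply: ler_sum => i _; apply: ler_sum => j _.
  by rewrite -real_normK ?num_real // ler_pXn2r // nnegrE.
by rewrite !sumr_const !card_ord -mulrnA -[leLHS]mulr_natl natrM exprMn -expr2 lexx.
Qed.

Lemma normr_entry_le X i j : `|X i j| <= frob X.
Proof.
rewrite -(@ler_pXn2r _ 2) ?nnegrE ?frob_ge0 // real_normK ?num_real //.
rewrite frob_sqr_sum (bigD1 i) //= (bigD1 j) //= -addrA lerDl.
rewrite addr_ge0 // ?sumr_ge0 // => k _; rewrite ?sqr_ge0 //.
by rewrite sumr_ge0 // => l _; exact: sqr_ge0.
Qed.

Lemma frob_dominated X Y a :
  0 <= a -> (forall i j, `|X i j| <= a * `|Y i j|) -> frob X <= a * frob Y.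
Proof.
move=> a0 h; rewrite -(@ler_pXn2r _ 2) ?nnegrE ?mulr_ge0 ?frob_ge0 //.
rewrite exprMn !frob_sqr_sum mulr_sumr; apply: ler_sum => i _.
rewrite mulr_sumr; apply: ler_sum => j _.
rewrite -[X i j ^+ 2]real_normK ?num_real // -[Y i j ^+ 2]real_normK ?num_real //.
by rewrite -exprMn ler_pXn2r // nnegrE ?mulr_ge0.
Qed.

End InnerProduct.

(** * Conjugation and isometric embeddings *)

Lemma mxinner_conj (R : realType) (p q : nat) (J : 'M[R]_(p, q)) (X : 'M[R]_q)
    (Y : 'M[R]_p) :
  mxinner (J *m X *m J^T) Y = mxinner X (J^T *m Y *m J).
Proof.
rewrite !mxinnerE !trmx_mul trmxK -!mulmxA mxtrace_mulC -!mulmxA //.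
Qed.

Section Isometry.
Context {R : realType} {p q : nat} (J : 'M[R]_(p, q)).
Hypothesis JJ : J^T *m J = 1%:M.
Implicit Types (X Y : 'M[R]_q).

Lemma mxinner_isom X Y : mxinner (J *m X *m J^T) (J *m Y *m J^T) = mxinner X Y.
Proof.
rewrite mxinner_conj; congr mxinner.
by rewrite !mulmxA JJ mul1mx -mulmxA JJ mulmx1.
Qed.

Lemma frob_isom X : frob (J *m X *m J^T) = frob X.
Proof. by rewrite /frob mxinner_isom. Qed.

End Isometry.

(** * Compactness for the Frobenius norm *)

Section Compactness.
Context {R : realType} {p : nat}.
Import numFieldNormedType.Exports.
Local Open Scope classical_set_scope.

Lemma vec_norm_le_frob (v : 'rV[R]_(p * p)) : `|v| <= frob (vec_mx v).
Proof.
rewrite [leLHS]/Num.norm /= mx_normrE; apply/bigmax_leP; split=> [|[i j] _ /=].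
  exact: frob_ge0.
have [k l] := mxvec_indexP j; rewrite ord1 -[X in `|X|](_ : vec_mx v k l = _).
  exact: normr_entry_le.
by rewrite mxE.
Qed.

Lemma frob_le_vec_norm (v : 'rV[R]_(p * p)) : frob (vec_mx v) <= p%:R * `|v|.
Proof.
apply: frob_le_entries => // i j; rewrite mxE.
rewrite [leRHS]/Num.norm /= mx_normrE.
by apply/bigmax_geP; right => /=; exists (0, mxvec_index i j).
Qed.

(** Extreme value theorem phrased through [frob]. Matrices are flattened to vectors, whose max norm
    is comparable to [frob]. The one-sided Lipschitz condition gives continuity because [X] and [Y]
    can be swapped. *)
Lemma argmax_exists (S : set 'M[R]_p) (f : 'M[R]_p -> R) (M c : R) :
  S !=set0 -> (forall X, S X -> frob X <= M) ->
  (forall X, (forall e, 0 < e -> exists2 Y, S Y & frob (X - Y) < e) -> S X) ->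
  0 <= c -> (forall X Y, S X -> S Y -> f X - f Y <= c * frob (X - Y)) ->
  exists2 X, S X & forall Y, S Y -> f Y <= f X.
Proof.
move=> [X0 SX0] Sbd Scl c0 flip.
pose V : set 'rV[R]_(p * p) := [set v | S (vec_mx v)].
have small (e : R) : 0 < e -> exists2 d : R, 0 < d &
    forall v : 'rV[R]_(p * p), `|v| < d -> frob (vec_mx v) < e.
  (* The [+ 1] keeps the divisor positive when [p = 0]. *)
  move=> e0; exists (e / (p%:R + 1)); first by rewrite divr_gt0 // ltr_wpDl.
  move=> v vd; apply: le_lt_trans (frob_le_vec_norm v) _.
  have [->|pp] := eqVneq (p%:R : R) 0; first by rewrite mul0r.
  have {}pp : 0 < p%:R :> R by rewrite lt_def pp ler0n.
  apply: (@lt_le_trans _ _ (p%:R * (e / (p%:R + 1)))); first by rewrite ltr_pM2l.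
  rewrite mulrCA ler_piMr ?(ltW e0) // ler_pdivrMr ?mul1r ?lerDl //.
  by rewrite ltr_wpDl.
have cV : compact V.
  apply: bounded_closed_compact.
    exists M; split; first exact: num_real.
    move=> a Ma v /= Sv; apply: le_trans (vec_norm_le_frob v) _.
    exact: le_trans (Sbd _ Sv) (ltW Ma).
  move=> v clv; apply: Scl => e /small[d d0 hd].
  have [w [Sw /= vw]] := clv _ (nbhsx_ballx v _ d0).
  exists (vec_mx w) => //; rewrite -linearB /=; apply: hd.
  by move: vw; rewrite -ball_normE.
have V0 : V !=set0 by exists (mxvec X0); rewrite /V /= mxvecK.
have fV : {within V, continuous (f \o vec_mx)}.
  apply/subspace_continuousP => v Sv; apply/cvgrPdist_lt => e e0.
  have /small[d d0 hd] : 0 < e / (c + 1) by rewrite divr_gt0 // ltr_wpDl.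
  apply/nbhs_ballP; exists d => //= w.
  rewrite -ball_normE /= => vw Sw.
  have := hd _ vw; rewrite linearB /= => vw'.
  apply: (@le_lt_trans _ _ (c * frob (vec_mx v - vec_mx w))).
    rewrite ler_norml lerNl opprB {1}frobC.
    by rewrite !flip.
  apply: (@le_lt_trans _ _ ((c + 1) * frob (vec_mx v - vec_mx w))).
    by rewrite ler_wpM2r ?frob_ge0 // lerDl.
  by rewrite mulrC -ltr_pdivlMr // ltr_wpDl.
have [v] := compact_EVT_max V0 cV fV.
rewrite inE => Sv vmax; exists (vec_mx v) => // Y SY.
have := vmax (mxvec Y); rewrite /= mxvecK; apply.
by rewrite inE /V /= mxvecK.
Qed.

End Compactness.

(** * The positive semidefinite cone *)

Section PsdCone.
Context {R : realType} {p : nat}.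
Implicit Types (X Y Z P : 'M[R]_p) (a c : R).
Local Open Scope classical_set_scope.

(** Makes the quadratic form visibly linear in [X], so that sums, multiples and limits in the cone
    reduce to rules for [mxinner]. *)
Lemma quadform_inner X (v : 'cV[R]_p) :
  (v^T *m X *m v) 0 0 = mxinner X (v *m v^T).
Proof.
rewrite mxinnerC mxinnerE trmx_mul trmxK -(mulmxA v) mxtrace_mulC.
by rewrite /mxtrace big_ord1.
Qed.

Lemma psd_rank1 (v : 'cV[R]_p) : psdmx (v *m v^T).
Proof.
split; first by rewrite /symmx trmx_mul trmxK.
move=> w; rewrite quadform_inner.
have -> : mxinner (v *m v^T) (w *m w^T) = (v^T *m w) 0 0 ^+ 2.
  rewrite -quadform_inner (mulmxA w^T) -(mulmxA _ v^T) mxE big_ord1 expr2; congr (_ * _).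
  by rewrite -[v^T *m w]trmxK trmx_mul trmxK [RHS]mxE.
exact: sqr_ge0.
Qed.

Lemma psd0 : psdmx (0 : 'M[R]_p).
Proof.
split; first by rewrite /symmx trmx0.
by move=> v; rewrite mulmx0 mul0mx mxE.
Qed.

Lemma psdD X Y : psdmx X -> psdmx Y -> psdmx (X + Y).
Proof.
move=> [sX hX] [sY hY]; split; first by rewrite /symmx linearD /= sX sY.
by move=> v; rewrite quadform_inner mxinnerDl -!quadform_inner addr_ge0.
Qed.

Lemma psdZ a X : 0 <= a -> psdmx X -> psdmx (a *: X).
Proof.
move=> a0 [sX hX]; split; first by rewrite /symmx linearZ /= sX.
by move=> v; rewrite quadform_inner mxinnerZl -quadform_inner mulr_ge0.
Qed.

Lemma symm_limit X :
  (forall e, 0 < e -> exists2 Y, symmx Y & frob (X - Y) < e) -> symmx X.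
Proof.
move=> h; apply/eqP; rewrite -subr_eq0; apply/eqP/frob_eq0/eqP.
rewrite eq_le frob_ge0 andbT; apply/ler_addgt0Pr => e e0; rewrite add0r.
have [|Y sY XY] := h (e / 2); first by rewrite divr_gt0.
rewrite (_ : _ - X = (X - Y)^T - (X - Y)); last first.
  by rewrite linearB /= sY opprB addrA subrK.
apply: le_trans (frobB _ _) _; rewrite frob_tr; lra.
Qed.

Lemma psd_limit X :
  (forall e, 0 < e -> exists2 Y, psdmx Y & frob (X - Y) < e) -> psdmx X.
Proof.
move=> h; split.
  by apply: symm_limit => e /h[Y [sY _] XY]; exists Y.
move=> v; rewrite quadform_inner; set V := _ *m _.
rewrite -oppr_le0; apply/ler_addgt0Pr => e e0; rewrite add0r.
have [|Y [_ hY] XY] := h (e / (frob V + 1)).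
  by rewrite divr_gt0 // ltr_wpDl ?frob_ge0.
have := hY v; rewrite quadform_inner -/V => YV.
have := mxinner_le_frob (Y - X) V; rewrite mxinnerBl frobC => h1.
suff : frob (X - Y) * frob V <= e by lra.
apply: (@le_trans _ _ (e / (frob V + 1) * (frob V + 1))).
  by rewrite ler_pM ?frob_ge0 ?(ltW XY) // lerDl.
by rewrite divfK // gt_eqF // ltr_wpDl ?frob_ge0.
Qed.

(* The polar form of Moreau's decomposition: unlike [psdmx (P - Z)] it does not
   rely on the self-duality of the cone. *)
Definition moreau Z P : Prop :=
  [/\ psdmx P, forall Y, psdmx Y -> mxinner (Z - P) Y <= 0
    & mxinner (Z - P) P = 0].

(** Testing each polar inequality at the other projection gives [|P - P'|^2 <= <Z - Z', P - P'>];
    Cauchy-Schwarz then cancels one factor. *)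
Lemma moreau_le Z Z' P P' : moreau Z P -> moreau Z' P' ->
  frob (P - P') <= frob (Z - Z').
Proof.
move=> [pP hP oP] [pP' hP' oP'].
have [->|PP] := eqVneq (frob (P - P')) 0; first exact: frob_ge0.
have PPp : 0 < frob (P - P') by rewrite lt_def PP frob_ge0.
rewrite -(ler_pM2r PPp) -expr2 frob_sqr.
apply: le_trans (mxinner_le_frob _ _).
have := hP _ pP'; have := hP' _ pP; move: oP oP'.
rewrite !mxinnerBl !mxinnerBr (mxinnerC P' P); lra.
Qed.

Lemma moreau_uniq Z P P' : moreau Z P -> moreau Z P' -> P = P'.
Proof.
move=> h h'; apply/eqP; rewrite -subr_eq0; apply/eqP/frob_eq0/eqP.
by rewrite eq_le frob_ge0 andbT -(frob0 (p := p)) -(subrr Z) moreau_le.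
Qed.

(** Division by [t] and [t -> 0], made explicit with [t = a / c], or [t = 1] if that exceeds 1.
    Restricting to [t <= 1] allows the direction [- P], along which [P - t P] must stay in the
    cone. *)
Lemma small_quadratic_le0 a c : 
  (forall t, 0 < t -> t <= 1 -> 2 * a * t <= c * t ^+ 2) -> a <= 0.
Proof.
move=> h; rewrite leNgt; apply/negP => a0.
have c0 : 0 < c by have := h 1 ltr01 (lexx 1); rewrite expr1n mulr1; lra.
have [ac|ca] := leP (a / c) 1.
  have := h (a / c) (divr_gt0 a0 c0) ac.
  rewrite (_ : c * _ = a * (a / c)); last by field; rewrite gt_eqF.
  have : 0 < a * (a / c) by rewrite mulr_gt0 ?divr_gt0.
  lra.
move: ca; rewrite ltr_pdivlMr // mul1r => ca.
by have := h 1 ltr01 (lexx 1); rewrite expr1n !mulr1; lra.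
Qed.

Lemma psd_proj_min Z : psdmx (psd_proj Z) /\
  forall Y, psdmx Y -> frob (Z - psd_proj Z) <= frob (Z - Y).
Proof.
(* Once a minimiser exists, [xget] returns one instead of its default 0. *)
suff [P hP] : exists P, psdmx P /\ forall Y, psdmx Y -> frob (Z - P) <= frob (Z - Y).
  by rewrite /psd_proj; case: xgetP => [_ -> //|/(_ P)].
(* Competitors no farther from [Z] than 0 form a nonempty closed set within radius [2 * frob Z]. *)
pose S : set 'M[R]_p := [set Y | psdmx Y /\ frob (Z - Y) <= frob Z].
have [|||||P [pP PZ] Pmax] := @argmax_exists _ _ S (fun Y => - frob (Z - Y)) (2 * frob Z) 1.
- by exists 0; split; [exact: psd0 | rewrite subr0].
- move=> Y [_ YZ]; rewrite -(subKr Z Y); apply: le_trans (frobB _ _) _; lra.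
- move=> X h; split; first by apply: psd_limit => e /h[Y [pY _] XY]; exists Y.
  apply/ler_addgt0Pr => e /h[Y [_ YZ] XY].
  rewrite -(subrK Y Z) -addrA; apply: le_trans (frobD _ _) _.
  by rewrite frobC in XY; rewrite subrK; lra.
- exact: ler01.
- move=> X Y _ _; rewrite opprK mul1r addrC lerBlDr.
  by rewrite -(subrKA X Z) addrC frobD.
- exists P; split => // Y pY.
  have [YZ|/ltW ZY] := leP (frob (Z - Y)) (frob Z); last exact: le_trans ZY.
  by rewrite -lerN2 Pmax.
Qed.

Lemma psd_proj_psd Z : psdmx (psd_proj Z).
Proof. by case: (psd_proj_min Z). Qed.

(** First-order optimality along segments in the cone: a direction [Y] in the cone gives the polar
    inequality, and [- P] gives the missing half of the orthogonality. *)
Lemma minimizer_moreau Z P : psdmx P ->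
  (forall Y, psdmx Y -> frob (Z - P) <= frob (Z - Y)) -> moreau Z P.
Proof.
move=> pP Pmin.
have var E t : psdmx (P + t *: E) ->
    2 * mxinner (Z - P) E * t <= mxinner E E * t ^+ 2.
  move=> /Pmin; rewrite frob_leP ?frob_ge0 // frob_sqr.
  rewrite opprD addrA; move: (Z - P) => D.
  rewrite mxinnerBl !mxinnerBr !mxinnerZl !mxinnerZr (mxinnerC E D).
  by move=> h; rewrite -subr_ge0; move: h; rewrite -subr_ge0; congr (0 <= _); ring.
have hpol Y : psdmx Y -> mxinner (Z - P) Y <= 0.
  move=> pY; apply: (@small_quadratic_le0 _ (mxinner Y Y)) => t t0 _.
  by apply: var; apply: psdD => //; apply: psdZ => //; exact: ltW.
split => //; apply/eqP; rewrite eq_le hpol //= -oppr_le0 -mxinnerNr.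
apply: (@small_quadratic_le0 _ (mxinner (- P) (- P))) => t t0 t1.
apply: var; rewrite scalerN -[X in X - _]scale1r -scalerBl.
by apply: psdZ => //; rewrite subr_ge0.
Qed.

Lemma psd_proj_moreau Z : moreau Z (psd_proj Z).
Proof. by have [] := psd_proj_min Z; exact: minimizer_moreau. Qed.

Lemma psd_proj_eq Z P : moreau Z P -> psd_proj Z = P.
Proof. exact: moreau_uniq (psd_proj_moreau Z). Qed.

Lemma psd_proj_lipschitz Z Z' : frob (psd_proj Z - psd_proj Z') <= frob (Z - Z').
Proof. exact: moreau_le (psd_proj_moreau Z) (psd_proj_moreau Z'). Qed.

Lemma psd_projZ a Z : 0 <= a -> psd_proj (a *: Z) = a *: psd_proj Z.
Proof.
move=> a0; apply: psd_proj_eq; have [pP hP oP] := psd_proj_moreau Z.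
split; rewrite -?scalerBr.
- exact: psdZ.
- by move=> Y pY; rewrite mxinnerZl mulr_ge0_le0 // hP.
- by rewrite mxinnerZl mxinnerZr oP !mulr0.
Qed.

Lemma psd_proj0 : psd_proj (0 : 'M[R]_p) = 0.
Proof. by rewrite -{1}(scale0r 0) psd_projZ // scale0r. Qed.

Lemma frob_psd_proj Z : frob (psd_proj Z) <= frob Z.
Proof. by have := psd_proj_lipschitz Z 0; rewrite psd_proj0 !subr0. Qed.

Lemma psd_diag_ge0 X i : psdmx X -> 0 <= X i i.
Proof.
move=> [_ /(_ (delta_mx i 0))].
rewrite trmx_delta -rowE.
by rewrite -colE !mxE.
Qed.

Lemma psd_sqr_le X i j : psdmx X -> X i j ^+ 2 <= X i i * X j j.
Proof.
move=> pX.
have q a c : 0 <= a ^+ 2 * X i i + 2 * (a * c) * X i j + c ^+ 2 * X j j.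
  have [sX /(_ (a *: delta_mx i 0 + c *: delta_mx j 0))] := pX.
  have -> : (a *: delta_mx i 0 + c *: delta_mx j 0)^T =
      a *: delta_mx 0 i + c *: delta_mx 0 j :> 'rV[R]_p.
    by rewrite linearD !linearZ /= !trmx_delta.
  rewrite !mulmxDl !mulmxDr -!scalemxAl -!scalemxAr.
  rewrite -!rowE -!colE !mxE.
  have -> : X j i = X i j by rewrite -{1}sX mxE.
  by congr (0 <= _); ring.
have Xi := psd_diag_ge0 i pX; have Xj := psd_diag_ge0 j pX.
(* The first two vectors give the minor times a diagonal entry. The third covers two null diagonal
   entries, where the form reduces to [-2 X_ij^2]. *)
have := q (X j j) (- X i j); have := q (- X i j) (X i i); have := q 1 (- X i j).
rewrite (_ : (X j j ^+ 2 * _ + _ + _) = X j j * (X i i * X j j - X i j ^+ 2)); last by ring.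
rewrite (_ : ((- X i j) ^+ 2 * _ + _ + _) = X i i * (X i i * X j j - X i j ^+ 2)); last by ring.
rewrite -[X in _ -> _ -> _ -> is_true X]subr_ge0 => h1 hi hj.
have [Xj0|Xj0] := eqVneq (X j j) 0; last first.
  by move: hj; rewrite pmulr_rge0 // lt_def Xj0.
have [Xi0|Xi0] := eqVneq (X i i) 0; last first.
  by move: hi; rewrite pmulr_rge0 // lt_def Xi0.
by move: h1; rewrite Xi0 Xj0; lra.
Qed.

Lemma psd_frob_le_trace X : psdmx X -> frob X <= \tr X.
Proof.
move=> pX; have tr0 : 0 <= \tr X by apply: sumr_ge0 => i _; exact: psd_diag_ge0.
rewrite -(@ler_pXn2r _ 2) ?nnegrE ?frob_ge0 // frob_sqr_sum.
rewrite [leRHS]expr2 /mxtrace mulr_suml; apply: ler_sum => i _.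
by rewrite mulr_sumr; apply: ler_sum => j _; exact: psd_sqr_le.
Qed.

End PsdCone.

Lemma psd_conj (R : realType) (p q : nat) (J : 'M[R]_(p, q)) (X : 'M[R]_q) :
  psdmx X -> psdmx (J *m X *m J^T).
Proof.
move=> [sX hX]; split; first by rewrite /symmx !trmx_mul trmxK sX mulmxA.
move=> v; have := hX (J^T *m v).
by rewrite trmx_mul trmxK !mulmxA.
Qed.

Lemma psd_conjT (R : realType) (p q : nat) (J : 'M[R]_(p, q)) (X : 'M[R]_p) :
  psdmx X -> psdmx (J^T *m X *m J).
Proof. by move=> /(psd_conj J^T); rewrite trmxK. Qed.

(** [J] may be rectangular: this serves both the eigenbasis and the embedding of the beta block.
    Test matrices are pulled back to the smaller cone by [J^T]. *)
Lemma psd_proj_conj (R : realType) (p q : nat) (J : 'M[R]_(p, q)) (Z : 'M[R]_q) :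
  J^T *m J = 1%:M -> psd_proj (J *m Z *m J^T) = J *m psd_proj Z *m J^T.
Proof.
move=> JJ; apply: psd_proj_eq; have [pP hP oP] := psd_proj_moreau Z.
split; first exact: psd_conj.
- move=> Y pY; rewrite -mulmxBl -mulmxBr mxinner_conj hP //.
  exact: psd_conjT.
- by rewrite -mulmxBl -mulmxBr mxinner_isom.
Qed.

(** * The constraint map and the orthogonal projector onto the range of its adjoint *)

Section ConstraintMap.
Context {R : realType} {n m : nat} (A : 'I_m -> 'M[R]_n).
Implicit Types (X Y : 'M[R]_n) (y z : 'cV[R]_m).

Lemma AopD X Y : Aop A (X + Y) = Aop A X + Aop A Y.
Proof. by apply/matrixP => i j; rewrite !mxE mxinnerDr. Qed.

Lemma AopZ a X : Aop A (a *: X) = a *: Aop A X.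
Proof. by apply/matrixP => i j; rewrite !mxE mxinnerZr. Qed.

Lemma AopB X Y : Aop A (X - Y) = Aop A X - Aop A Y.
Proof. by rewrite AopD -scaleN1r AopZ scaleN1r. Qed.

Lemma AadjD y z : Aadj A (y + z) = Aadj A y + Aadj A z.
Proof. by rewrite -big_split /=; apply: eq_bigr => i _; rewrite mxE scalerDl. Qed.

Lemma AadjZ a y : Aadj A (a *: y) = a *: Aadj A y.
Proof. by rewrite scaler_sumr; apply: eq_bigr => i _; rewrite mxE scalerA. Qed.

Lemma mxinner_Aadj y X : mxinner (Aadj A y) X = (y^T *m Aop A X) 0 0.
Proof.
rewrite mxinner_suml mxE; apply: eq_bigr => i _.
by rewrite mxinnerZl !mxE.
Qed.

Lemma AAadjE y : AAadj A *m y = Aop A (Aadj A y).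
Proof.
apply/matrixP => i j; rewrite !mxE mxinnerC mxinner_suml.
apply: eq_bigr => k _; rewrite !mxE mxinnerZl ord1 mulrC.
by rewrite mxinnerC.
Qed.

Lemma tr_AAadj : (AAadj A)^T = AAadj A.
Proof. by apply/matrixP => i j; rewrite !mxE mxinnerC. Qed.

Lemma symm_Aadj y : (forall i, symmx (A i)) -> symmx (Aadj A y).
Proof.
move=> sA; rewrite /symmx /Aadj linear_sum; apply: eq_bigr => i _.
by rewrite linearZ /= sA.
Qed.

Lemma PopD X Y : Pop A (X + Y) = Pop A X + Pop A Y.
Proof. by rewrite /Pop AopD mulmxDr AadjD. Qed.

Lemma PopZ a X : Pop A (a *: X) = a *: Pop A X.
Proof. by rewrite /Pop AopZ -scalemxAr AadjZ. Qed.

Lemma PopN X : Pop A (- X) = - Pop A X.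
Proof. by rewrite -scaleN1r PopZ scaleN1r. Qed.

Lemma PopB X Y : Pop A (X - Y) = Pop A X - Pop A Y.
Proof. by rewrite PopD PopN. Qed.

Hypothesis A_surj : forall v : 'cV[R]_m, exists X, symmx X /\ Aop A X = v.

(** A kernel vector [u] has [|Aadj u|^2 = 0]; pairing [Aadj u = 0] with a preimage of [u] under
    [Aop] gives [|u|^2 = 0]. Thus [invmx] in [Pop] is a true inverse. *)
Lemma AAadj_unit : AAadj A \in unitmx.
Proof.
rewrite -row_free_unit -kermx_eq0; apply/eqP/row_matrixP => i; rewrite row0.
set u := row i _.
have uA : u *m AAadj A = 0 by apply/sub_kermxP; rewrite row_sub.
have Au : AAadj A *m u^T = 0 by rewrite -tr_AAadj -trmx_mul uA trmx0.
have Aadj0 : Aadj A u^T = 0.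
  by apply: mxinner_eq0; rewrite mxinner_Aadj -AAadjE Au mulmx0 mxE.
have [X [_ AX]] := A_surj u^T.
have := mxinner_Aadj u^T X; rewrite Aadj0 mxinner0l AX trmxK => uu.
apply/rowP => k; rewrite [RHS]mxE; apply/eqP; rewrite -sqrf_eq0.
move/esym/eqP: uu; rewrite mxE psumr_eq0 => [/allP/(_ k (mem_index_enum k))|j _].
  by rewrite /= [u^T _ _]mxE -expr2.
by rewrite [u^T _ _]mxE -expr2 sqr_ge0.
Qed.

Lemma Aop_Pop X : Aop A (Pop A X) = Aop A X.
Proof. by rewrite -AAadjE mulKVmx // AAadj_unit. Qed.

Lemma Pop_Aadj y : Pop A (Aadj A y) = Aadj A y.
Proof. by rewrite /Pop -AAadjE mulKmx // AAadj_unit. Qed.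

(** [Pop] lands in the range of the adjoint and [Pperp] in the kernel of [Aop]. *)
Lemma mxinner_Pop_Pperp X Y : mxinner (Pop A X) (Pperp A Y) = 0.
Proof. by rewrite mxinner_Aadj AopB Aop_Pop subrr mulmx0 mxE. Qed.

Lemma frob_Pop_add_Pperp X Y :
  frob (Pop A X + Pperp A Y) ^+ 2 = frob (Pop A X) ^+ 2 + frob (Pperp A Y) ^+ 2.
Proof.
have := mxinner_Pop_Pperp X Y; rewrite !frob_sqr; move: (Pperp A Y) => Z XZ.
by rewrite mxinnerDl !mxinnerDr (mxinnerC Z) XZ addr0 add0r.
Qed.

Lemma frob_sqr_split X :
  frob X ^+ 2 = frob (Pop A X) ^+ 2 + frob (Pperp A X) ^+ 2.
Proof. by rewrite -frob_Pop_add_Pperp subrKC. Qed.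

Lemma frob_Pop X : frob (Pop A X) <= frob X.
Proof.
rewrite -(@ler_pXn2r _ 2) ?nnegrE ?frob_ge0 // (frob_sqr_split X).
by rewrite lerDl sqr_ge0.
Qed.

Lemma frob_Pperp X : frob (Pperp A X) <= frob X.
Proof.
rewrite -(@ler_pXn2r _ 2) ?nnegrE ?frob_ge0 // (frob_sqr_split X).
by rewrite lerDr sqr_ge0.
Qed.

End ConstraintMap.

(** * Second-order expansion of the projection at a diagonal matrix *)

Section Mask.
Context {R : realType} {n : nat}.
Implicit Types (b : pred 'I_n) (X Y : 'M[R]_n).

(** A principal block kept in place at full size, so that blocks of different sizes can be added
    without casts between dimensions. *)
Definition maskmx b X : 'M[R]_n :=
  \matrix_(i, j) if b i && b j then X i j else 0.

Lemma maskmxD b X Y : maskmx b (X + Y) = maskmx b X + maskmx b Y.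
Proof. by apply/matrixP => i j; rewrite !mxE; case: ifP; rewrite ?addr0. Qed.

Lemma maskmxZ b a X : maskmx b (a *: X) = a *: maskmx b X.
Proof. by apply/matrixP => i j; rewrite !mxE; case: ifP => // _; rewrite mulr0. Qed.

Lemma maskmxN b X : maskmx b (- X) = - maskmx b X.
Proof. by rewrite -scaleN1r maskmxZ scaleN1r. Qed.

Lemma maskmxB b X Y : maskmx b (X - Y) = maskmx b X - maskmx b Y.
Proof. by rewrite maskmxD maskmxN. Qed.

Lemma maskmxK b X : maskmx b (maskmx b X) = maskmx b X.
Proof. by apply/matrixP => i j; rewrite !mxE; case: (b i && b j). Qed.

Lemma tr_maskmx b X : (maskmx b X)^T = maskmx b X^T.
Proof. by apply/matrixP => i j; rewrite !mxE andbC. Qed.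

Lemma mxinner_mask b X Y : mxinner (maskmx b X) Y = mxinner X (maskmx b Y).
Proof.
apply: eq_bigr => i _; apply: eq_bigr => j _; rewrite !mxE.
by case: ifP => // _; rewrite mul0r mulr0.
Qed.

Lemma mxinner_mask_disjoint b b' X Y :
  (forall i, b i -> ~~ b' i) -> mxinner (maskmx b X) (maskmx b' Y) = 0.
Proof.
move=> bb'; rewrite /mxinner big1 // => i _; rewrite big1 // => j _.
rewrite !mxE; case: (boolP (b i)) => [/bb'/negbTE->|_] /=; last by rewrite mul0r.
by rewrite mulr0.
Qed.

Lemma frob_mask b X : frob (maskmx b X) <= frob X.
Proof.
rewrite -[leRHS]mul1r; apply: frob_dominated => // i j; rewrite mxE mul1r.
by case: ifP => // _; rewrite normr0.
Qed.

Lemma maskmx_diagE b X (E := diag_mx (\row_i (b i)%:R) : 'M[R]_n) :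
  maskmx b X = E *m X *m E^T.
Proof.
apply/matrixP => i j; rewrite tr_diag_mx mul_mx_diag mul_diag_mx !mxE.
by case: (b i); case: (b j); rewrite /= ?(mul1r, mul0r, mulr1, mulr0).
Qed.

Lemma psd_mask b X : psdmx X -> psdmx (maskmx b X).
Proof. by rewrite maskmx_diagE; exact: psd_conj. Qed.

(** Masking the projection keeps it in the cone and brings it no farther from the masked matrix, so
    uniqueness of the projection applies. *)
Lemma psd_proj_mask b X :
  maskmx b (psd_proj (maskmx b X)) = psd_proj (maskmx b X).
Proof.
have [pP Pmin] := psd_proj_min (maskmx b X).
apply/esym/psd_proj_eq/minimizer_moreau; first exact: psd_mask.
move=> Y pY; apply: le_trans (Pmin _ pY).
by rewrite -[X in X - maskmx b _]maskmxK -maskmxB frob_mask.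
Qed.

(** With [Z] the masked [Y], [<X, Z> >= - |X| |Z| >= - |X| tr Z], and the diagonal part outweighs
    this since its entries on [b] are at least [|X|]. *)
Lemma mask_diagD_dual_psd b (d : 'rV[R]_n) X Y :
  (forall i, b i -> frob X <= d 0 i) -> psdmx Y ->
  0 <= mxinner (maskmx b (diag_mx d + X)) Y.
Proof.
move=> dX pY; rewrite mxinner_mask mxinnerDl.
have pY' := psd_mask b pY; set Z := maskmx b Y in pY' *.
have : - (frob X * frob Z) <= mxinner X Z.
  by have := normr_mxinner_le X Z; rewrite ler_norml => /andP[].
have : frob X * frob Z <= frob X * \tr Z.
  by rewrite ler_wpM2l ?frob_ge0 // psd_frob_le_trace.
suff : frob X * \tr Z <= mxinner (diag_mx d) Z by lra.
rewrite mxinnerE tr_diag_mx /mxtrace mulr_sumr; apply: ler_sum => i _.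
rewrite mul_diag_mx [leRHS]mxE.
have [bi|/negbTE bi] := boolP (b i); last by rewrite !mxE bi !mulr0.
by rewrite ler_wpM2r ?dX // psd_diag_ge0.
Qed.

Lemma mask_diagD_psd b (d : 'rV[R]_n) X :
  symmx X -> (forall i, b i -> frob X <= d 0 i) ->
  psdmx (maskmx b (diag_mx d + X)).
Proof.
move=> sX dX; split.
  by rewrite /symmx tr_maskmx linearD /= tr_diag_mx sX.
by move=> v; rewrite quadform_inner mask_diagD_dual_psd //; exact: psd_rank1.
Qed.

End Mask.

Lemma norm_gap (R : realType) (n : nat) (lam : 'I_n -> R) :
  exists2 c, 0 < c & forall i, lam i != 0 -> c <= `|lam i|.
Proof.
(* Null eigenvalues contribute [0^-1 = 0], and the 1 keeps [s] positive when there is nothing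
   else. *)
pose s := 1 + \sum_i `|lam i|^-1.
have s0 : 0 < s by rewrite ltr_wpDr // sumr_ge0 // => i _; rewrite invr_ge0.
exists s^-1; first by rewrite invr_gt0.
move=> i li; rewrite -[leRHS]invrK lef_pV2 ?posrE ?invr_gt0 ?normr_gt0 //.
rewrite /s (bigD1 i) //= addrCA lerDl addr_ge0 // sumr_ge0 // => j _.
by rewrite invr_ge0.
Qed.

(** The remainder is [U (D - D0) + (D - D0) U^T + U D U^T]: the first two terms give [6 u], the last
    [u^2 d]. *)
Lemma sandwich_bound (R : realType) (n : nat) (U D D0 : 'M[R]_n) (u d h : R) :
  frob U <= u * h -> frob (D - D0) <= 3 * h -> frob D <= d ->
  frob ((1%:M + U) *m D *m (1%:M + U)^T - (D + U *m D0 + D0 *m U^T))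
    <= (6 * u + u ^+ 2 * d) * h ^+ 2.
Proof.
move=> hU hD0 hD.
have -> : (1%:M + U) *m D *m (1%:M + U)^T - (D + U *m D0 + D0 *m U^T) =
    U *m (D - D0) + (D - D0) *m U^T + U *m D *m U^T.
  have -> : (1%:M + U)^T = 1%:M + U^T by rewrite linearD /= trmx1.
  rewrite !(mulmxDl, mulmxDr, mulNmx, mulmxN, mul1mx, mulmx1).
  move: (U *m D) (D *m _) (U *m D0) (D0 *m _) (U *m D *m _) => a b a' b' e.
  by apply/matrixP => i j; rewrite !mxE; ring.
apply: le_trans (frobD _ _) _; rewrite mulrDl; apply: lerD.
  apply: (@le_trans _ _ (2 * (u * h * (3 * h)))); last by lra.
  rewrite mulr2n mulrDl !mul1r; apply: le_trans (frobD _ _) _.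
  apply: lerD; apply: le_trans (frobM _ _) _.
    by rewrite ler_pM ?frob_ge0.
  by rewrite frob_tr mulrC ler_pM ?frob_ge0.
apply: le_trans (frobM _ _) _; rewrite frob_tr.
rewrite (_ : _ * h ^+ 2 = u * h * d * (u * h)); last by ring.
apply: ler_pM; rewrite ?frob_ge0 //; apply: le_trans (frobM _ _) _.
by rewrite ler_pM ?frob_ge0.
Qed.

(** A sign split whose strict cases carry rewrite rules for every sign-dependent function, so that
    one script settles all nine sign pairs of two eigenvalues. *)
Lemma sign_rules (R : realType) (x : R) :
  (0 < x) * (((0 < x) = true) * ((x < 0) = false) * ((x == 0) = false) *
    (Num.sg x = 1) * (`|x| = x) * (Num.max x 0 = x) * (Num.min x 0 = 0)) +
  (x < 0) * (((0 < x) = false) * ((x < 0) = true) * ((x == 0) = false) *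
    (Num.sg x = -1) * (`|x| = - x) * (Num.max x 0 = 0) * (Num.min x 0 = x)) +
  (x = 0).
Proof.
have [x0|x0|x0] := ltrgtP x 0.
- by left; right; do !split; rewrite ?ltr0_sg ?ltr0_norm.
- by left; left; do !split; rewrite ?gtr0_sg ?gtr0_norm.
- by right.
Qed.

Section ScalarIdentities.
Context {R : realType}.
Implicit Types x y a : R.

(** Scalar models of an entry of [K] and of [weight]: [x], [y] stand for [lam i], [lam j] and [a]
    for [H i j]. Swapping [x] and [y] transposes. *)
Let k x y a := if Num.sg x < Num.sg y then a / (`|x| + `|y|) else 0.
Let w x y := (Num.max x 0 + Num.max y 0) / (`|x| + `|y|).

Let sg_lt : ((0 < 1 :> R) = true) * ((1 < 0 :> R) = false) *
  ((-1 < 0 :> R) = true) * ((0 < -1 :> R) = false) *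
  ((-1 < 1 :> R) = true) * ((1 < -1 :> R) = false).
Proof. by do !split; lra. Qed.

Lemma pos_first_order x y a :
  (if (0 < x) && (0 < y) then a else 0) + k x y a * Num.max y 0
    + Num.max x 0 * k y x a = w x y * a.
Proof.
rewrite /k /w; case: (sign_rules x) => [[[x0 rx]|[x0 rx]]|rx];
  case: (sign_rules y) => [[[y0 ry]|[y0 ry]]|ry];
  rewrite !(rx, ry) ?ltxx ?eqxx /= ?sgr0 ?normr0 ?maxxx ?invr0 ?sg_lt
    ?(addr0, add0r, mul0r, mulr0) //; field; apply/eqP; lra.
Qed.

Lemma neg_first_order x y a :
  (if (x < 0) && (y < 0) then - a else 0) - (if (x == 0) && (y == 0) then a else 0)
    - k y x a * (- Num.min y 0) - (- Num.min x 0) * k x y a = w x y * a - a.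
Proof.
rewrite /k /w; case: (sign_rules x) => [[[x0 rx]|[x0 rx]]|rx];
  case: (sign_rules y) => [[[y0 ry]|[y0 ry]]|ry];
  rewrite !(rx, ry) ?ltxx ?eqxx /= ?sgr0 ?normr0 ?maxxx ?minxx ?invr0 ?sg_lt
    ?(addr0, add0r, mul0r, mulr0, oppr0, subr0, sub0r) //; field; apply/eqP; lra.
Qed.

End ScalarIdentities.

Section Expansion.
Context {R : realType} {n : nat} (lam : 'I_n -> R).
Implicit Types H : 'M[R]_n.

Let pos : pred 'I_n := fun i => 0 < lam i.
Let zer : pred 'I_n := fun i => lam i == 0.
Let neg : pred 'I_n := fun i => lam i < 0.
Let L : 'rV[R]_n := \row_i lam i.
Let Lp : 'rV[R]_n := \row_i Num.max (lam i) 0.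
Let Lm : 'rV[R]_n := \row_i - Num.min (lam i) 0.

(* Equals 1 on the blocks alpha-alpha and alpha-beta, the paper's Theta on
   gamma-alpha, and 0 elsewhere; on beta-beta this is the junk value 0/0 = 0. *)
Definition weight (i j : 'I_n) : R :=
  (Num.max (lam i) 0 + Num.max (lam j) 0) / (`|lam i| + `|lam j|).

Definition weighted H : 'M[R]_n := \matrix_(i, j) (weight i j * H i j).

(** [Dtil] seen in the eigenbasis, free of index arithmetic. As [weight] vanishes on the zero block,
    the projected block is simply added. *)
Definition dproj H : 'M[R]_n := weighted H + psd_proj (maskmx zer H).

Lemma weight_ge0 i j : 0 <= weight i j.
Proof. by rewrite divr_ge0 ?addr_ge0 // le_max lexx orbT. Qed.

Lemma weight_le1 i j : weight i j <= 1.
Proof.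
have [h|h] := eqVneq (`|lam i| + `|lam j|) 0; first by rewrite /weight h invr0 mulr0.
rewrite ler_pdivrMr ?mul1r; last by rewrite lt_def h addr_ge0.
by rewrite lerD // ge_max normr_ge0 ler_norm.
Qed.

Lemma weightedB H H' : weighted (H - H') = weighted H - weighted H'.
Proof. by apply/matrixP => i j; rewrite !mxE mulrBr. Qed.

Lemma frob_weighted H : frob (weighted H) <= frob H.
Proof.
rewrite -[leRHS]mul1r; apply: frob_dominated => // i j.
by rewrite mxE normrM ger0_norm ?weight_ge0 // ler_wpM2r // weight_le1.
Qed.

Lemma dprojZ a H : 0 <= a -> dproj (a *: H) = a *: dproj H.
Proof.
move=> a0; rewrite /dproj maskmxZ psd_projZ // scalerDr; congr (_ + _).
by apply/matrixP => i j; rewrite !mxE mulrCA.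
Qed.

Lemma dproj_lipschitz H H' : frob (dproj H - dproj H') <= 2 * frob (H - H').
Proof.
rewrite /dproj opprD addrACA -weightedB; apply: le_trans (frobD _ _) _.
have := frob_weighted (H - H').
have := psd_proj_lipschitz (maskmx zer H) (maskmx zer H').
rewrite -maskmxB; have := frob_mask zer (H - H'); lra.
Qed.

(* First-order variation of the eigenbasis; it is strictly block lower
   triangular for the three sign blocks of [lam], hence cubes to 0. *)
Let K H : 'M[R]_n := \matrix_(i, j)
  if Num.sg (lam i) < Num.sg (lam j) then H i j / (`|lam i| + `|lam j|) else 0.

(** A nonzero term would need four strictly increasing values of [Num.sg], which takes only
    three. *)
Lemma K_cube H : K H *m K H *m K H = 0.
Proof.
apply/matrixP => i j; rewrite mxE big1 ?mxE // => k _; rewrite mxE.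
rewrite mulr_suml big1 // => l _; rewrite !mxE.
case: ifP => [il|_]; last by rewrite !mul0r.
case: ifP => [lk|_]; last by rewrite mulr0 mul0r.
case: ifP => [kj|_]; last by rewrite mulr0.
exfalso; move: il lk kj.
by case: (sgrP (lam i)); case: (sgrP (lam l)); case: (sgrP (lam k));
  case: (sgrP (lam j)) => *; lra.
Qed.

(** [D1] and [D2] share out the perturbed spectrum by sign. The zero block of [H] is split by
    Moreau: its projection goes to [D1], the negative of its polar part to [D2]. *)
Let D1 H := maskmx pos (diag_mx L + H) + psd_proj (maskmx zer H).
Let D2 H := maskmx neg (diag_mx (- L) - H)
            + (psd_proj (maskmx zer H) - maskmx zer H).
(** Chosen so that [1 - T] is the transpose of [1 - K + K^2], the Neumann inverse of [1 + K], exact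
    because [K] cubes to 0. *)
Let T H := (K H)^T - (K H)^T *m (K H)^T.
Let approx_pos H := (1%:M + K H) *m D1 H *m (1%:M + K H)^T.
Let approx_neg H := (1%:M - T H) *m D2 H *m (1%:M - T H)^T.

Lemma frame_dual H : (1%:M - T H)^T *m (1%:M + K H) = 1%:M.
Proof.
have -> : (1%:M - T H)^T = 1%:M - K H + K H *m K H.
  by rewrite linearB /= trmx1 linearB /= trmx_mul trmxK opprB addrCA addrC -addrA.
rewrite mulmxDr mulmx1 !mulmxDl mul1mx K_cube addr0 mulNmx.
by rewrite addrACA subrr addr0 subrK.
Qed.

(** The three sign masks are disjoint, so only the pairing inside the zero block remains, and
    Moreau's orthogonality kills it. *)
Lemma mxinner_D1_D2 H : mxinner (D2 H) (D1 H) = 0.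
Proof.
rewrite /D1 /D2 -(psd_proj_mask zer H) -maskmxB.
rewrite mxinnerDl !mxinnerDr.
rewrite mxinner_mask_disjoint; last by move=> i; rewrite /neg /pos -leNgt => /ltW.
rewrite mxinner_mask_disjoint; last by move=> i; rewrite /neg /zer => /ltr0_neq0.
rewrite mxinner_mask_disjoint; last first.
  by move=> i; rewrite /zer /pos => /eqP ->; rewrite ltxx.
rewrite mxinner_mask maskmxK psd_proj_mask mxinnerBl.
have [_ _] := psd_proj_moreau (maskmx zer H).
by rewrite mxinnerBl mxinner_mask psd_proj_mask => h; lra.
Qed.

(** [pos_first_order] settles the perturbation entry by entry; the diagonal adds only that masking
    [L] yields [Lp]. *)
Lemma first_order_pos H : symmx H ->
  D1 H + K H *m diag_mx Lp + diag_mx Lp *m (K H)^T = diag_mx Lp + dproj H.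
Proof.
move=> sH; apply/matrixP => i j.
have Hji : H j i = H i j by rewrite -{1}sH mxE.
rewrite mul_mx_diag mul_diag_mx !mxE /pos Hji /weight; set P := psd_proj _ i j.
have := pos_first_order (lam i) (lam j) (H i j) => <-.
rewrite [`|lam j| + _]addrC.
have [<-|ij] := eqVneq i j; rewrite ?mulr1n ?mulr0n; last by rewrite add0r; case: ifP => _; ring.
case: (sign_rules (lam i)) => [[[_ r]|[_ r]]|r]; rewrite !r ?ltxx ?maxxx /=; ring.
Qed.

Lemma first_order_neg H : symmx H ->
  D2 H - (K H)^T *m diag_mx Lm - diag_mx Lm *m K H
    = diag_mx Lp + dproj H - (diag_mx L + H).
Proof.
move=> sH; apply/matrixP => i j.
have Hji : H j i = H i j by rewrite -{1}sH mxE.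
rewrite mul_mx_diag mul_diag_mx !mxE /neg /zer Hji /weight; set P := psd_proj _ i j.
have -> (x y z t : R) : x + (y + z) - (t + H i j) = x + (y - H i j) + z - t by ring.
have := neg_first_order (lam i) (lam j) (H i j) => <-.
have [<-|ij] := eqVneq i j; rewrite ?mulr1n ?mulr0n; last first.
  rewrite ?sub0r; case: (_ && _); case: (_ && _); ring.
case: (sign_rules (lam i)) => [[[_ r]|[_ r]]|r]; rewrite !r ?ltxx ?eqxx ?maxxx /=; ring.
Qed.

(** Smallness of [H] keeps the masked nonzero blocks semidefinite. Duality of the frames cancels
    them in the pairing and reduces orthogonality to that of [D1] and [D2]. *)
Lemma approx_moreau H : symmx H -> (forall i, lam i != 0 -> frob H <= `|lam i|) ->
  moreau (approx_pos H - approx_neg H) (approx_pos H).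
Proof.
move=> sH small.
have pD1 : psdmx (D1 H).
  apply: psdD; last exact: psd_proj_psd.
  apply: mask_diagD_psd => // i pi; rewrite mxE.
  by apply: le_trans (small i _) _; rewrite ?gtr0_norm // gt_eqF.
have dD2 Y : psdmx Y -> 0 <= mxinner (D2 H) Y.
  move=> pY; rewrite mxinnerDl addr_ge0 //.
    apply: mask_diagD_dual_psd => // i ni; rewrite !mxE frobN.
    by apply: le_trans (small i _) _; rewrite ?ltr0_norm // lt_eqF.
  have [_ h _] := psd_proj_moreau (maskmx zer H).
  by rewrite -opprB mxinnerNl oppr_ge0 h.
split; rewrite ?[_ - _ - _]addrC ?addKr.
- exact: psd_conj.
- move=> Y pY; rewrite mxinnerNl oppr_le0 mxinner_conj dD2 //.
  exact: psd_conjT.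
- rewrite mxinnerNl mxinner_conj /approx_pos !mulmxA frame_dual mul1mx -mulmxA.
  by rewrite -[_ *m (1%:M - T H)]trmxK trmx_mul trmxK frame_dual trmx1 mulmx1
    mxinner_D1_D2 oppr0.
Qed.

Lemma mask_pos_diag : maskmx pos (diag_mx L) = diag_mx Lp.
Proof.
apply/matrixP => i j; rewrite !mxE /pos.
have [<-|ij] := eqVneq i j; last by rewrite !mulr0n; case: ifP.
by case: (sign_rules (lam i)) => [[[_ r]|[_ r]]|r]; rewrite !r ?ltxx ?maxxx.
Qed.

Lemma mask_neg_diag : maskmx neg (diag_mx (- L)) = diag_mx Lm.
Proof.
apply/matrixP => i j; rewrite !mxE /neg.
have [<-|ij] := eqVneq i j; last by rewrite !mulr0n; case: ifP.
by case: (sign_rules (lam i)) => [[[_ r]|[_ r]]|r]; rewrite !r ?ltxx ?minxx ?oppr0.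
Qed.

Lemma psd_proj_expansion : exists C delta : R, [/\ 0 <= C, 0 < delta &
  forall H, symmx H -> frob H <= delta ->
    frob (psd_proj (diag_mx L + H) - (diag_mx Lp + dproj H)) <= C * frob H ^+ 2].
Proof.
have [c c0 gap] := norm_gap lam.
(* [l] bounds [D1], [D2] and [Lm] once [|H| <= 1]; below, [u] bounds [K] and [u'] bounds [T],
   relative to [|H|]. The last term of [C2] pays for the quadratic part of [T]. *)
pose l := frob (diag_mx Lp) + frob (diag_mx Lm) + 3.
have l0 : 0 <= l by rewrite !addr_ge0 ?frob_ge0.
pose u := c^-1; have u0 : 0 <= u by rewrite invr_ge0 ltW.
pose u' := u + u ^+ 2; have u'0 : 0 <= u' by rewrite addr_ge0 ?exprn_ge0.
pose C1 := 6 * u + u ^+ 2 * l; pose C2 := 6 * u' + u' ^+ 2 * l + 2 * (u ^+ 2 * l).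
have C10 : 0 <= C1 by rewrite addr_ge0 ?mulr_ge0 ?exprn_ge0.
have C20 : 0 <= C2 by rewrite !addr_ge0 ?mulr_ge0 ?exprn_ge0.
(* [C1] counts twice: the error of [approx_pos] enters the target and also, with that of
   [approx_neg], the distance between the projected matrices. *)
exists (C1 + C1 + C2), (Num.min c 1); split.
- by lra.
- by rewrite lt_min c0 ltr01.
move=> H sH; rewrite le_min => /andP[Hc H1].
set h := frob H in Hc H1 *; have h0 : 0 <= h by exact: frob_ge0.
have Kh : frob (K H) <= u * h.
  apply: frob_dominated => // i j; rewrite mxE.
  case: ifP => [ij|_]; last by rewrite normr0 mulr_ge0.
  rewrite normrM normfV mulrC ler_wpM2r // lef_pV2 ?posrE //.
    rewrite ger0_norm ?addr_ge0 //.
    have [i0|i0] := eqVneq (lam i) 0.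
      rewrite ler_wpDl // gap //; apply: contraTneq ij => ->.
      by rewrite i0 ltxx.
    by rewrite ler_wpDr // gap.
  (* A null denominator means two null eigenvalues, whose signs are not strictly ordered. *)
  rewrite normr_gt0; apply/eqP => z.
  have iz : lam i = 0 by apply/eqP; rewrite -normr_le0 -z lerDl.
  have jz : lam j = 0 by apply/eqP; rewrite -normr_le0 -z lerDr.
  by rewrite iz jz ltxx in ij.
have KTh : frob (K H)^T <= u * h by rewrite frob_tr.
have K2h : frob (K H *m K H) <= u ^+ 2 * h ^+ 2.
  by apply: le_trans (frobM _ _) _; rewrite -exprMn expr2 ler_pM ?frob_ge0.
have KT2h : frob ((K H)^T *m (K H)^T) <= u ^+ 2 * h ^+ 2.
  by rewrite -trmx_mul frob_tr.
have Th : frob (- T H) <= u' * h.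
  rewrite frobN; apply: le_trans (frobB _ _) _; rewrite mulrDl lerD //.
  apply: (le_trans KT2h); rewrite ler_wpM2l ?exprn_ge0 // expr2.
  by rewrite ler_piMl.
have Ph : frob (psd_proj (maskmx zer H)) <= h.
  by apply: le_trans (frob_psd_proj _) (frob_mask _ _).
have D1L : frob (D1 H - diag_mx Lp) <= 3 * h.
  have -> : D1 H - diag_mx Lp = maskmx pos H + psd_proj (maskmx zer H).
    by rewrite /D1 maskmxD mask_pos_diag addrC -addrA addKr.
  apply: le_trans (frobD _ _) _; have := frob_mask pos H; rewrite -/h; lra.
have D2L : frob (D2 H - diag_mx Lm) <= 3 * h.
  have -> : D2 H - diag_mx Lm = (psd_proj (maskmx zer H) - maskmx zer H) - maskmx neg H.
    by rewrite /D2 maskmxB mask_neg_diag addrC -addrA addKr addrC.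
  apply: le_trans (frobB _ _) _; have := frob_mask neg H.
  have := frobB (psd_proj (maskmx zer H)) (maskmx zer H); have := frob_mask zer H.
  rewrite -/h; lra.
have D1l : frob (D1 H) <= l.
  rewrite -(subrK (diag_mx Lp) (D1 H)); apply: le_trans (frobD _ _) _.
  have := frob_ge0 (diag_mx Lm); rewrite /l; lra.
have D2l : frob (D2 H) <= l.
  rewrite -(subrK (diag_mx Lm) (D2 H)); apply: le_trans (frobD _ _) _.
  have := frob_ge0 (diag_mx Lp); rewrite /l; lra.
have R1 : frob (approx_pos H - (diag_mx Lp + dproj H)) <= C1 * h ^+ 2.
  by rewrite -first_order_pos //; exact: sandwich_bound.
have Lml : frob (diag_mx Lm) <= l.
  have := frob_ge0 (diag_mx Lp); rewrite /l; lra.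
have R2 : frob (approx_neg H - (diag_mx Lp + dproj H - (diag_mx L + H)))
    <= C2 * h ^+ 2.
  rewrite -first_order_neg //.
  have := sandwich_bound Th D2L D2l; rewrite -/(approx_neg H).
  set S := D2 H + _ + _ => hS.
  (* [sandwich_bound] is centred at the expansion with [T]; replacing [T] by [K^T] costs two
     products of second order. *)
  have -> : D2 H - (K H)^T *m diag_mx Lm - diag_mx Lm *m K H =
    S - ((K H)^T *m (K H)^T *m diag_mx Lm + diag_mx Lm *m (K H *m K H)).
    have -> : S = D2 H - T H *m diag_mx Lm - diag_mx Lm *m (T H)^T.
      by rewrite /S mulNmx linearN /= mulmxN.
    have -> : T H *m diag_mx Lm =
        (K H)^T *m diag_mx Lm - (K H)^T *m (K H)^T *m diag_mx Lm.
      exact: mulmxBl.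
    have -> : (T H)^T = K H - K H *m K H by rewrite linearB /= trmx_mul trmxK.
    rewrite mulmxBr.
    move: (D2 H) (_ *m diag_mx Lm) (_ *m _ *m diag_mx Lm) (_ *m K H) (_ *m (_ *m _)).
    by move=> a b d e f; apply/matrixP => i j; rewrite !mxE; ring.
  rewrite opprB addrA addrAC.
  apply: le_trans (frobD _ _) _; rewrite mulrDl lerD //.
  apply: le_trans (frobD _ _) _; rewrite mulr2n mulrDl mul1r mulrDl lerD //.
    apply: le_trans (frobM _ _) _.
    by rewrite mulrAC ler_pM ?frob_ge0.
  apply: le_trans (frobM _ _) _.
  by rewrite mulrAC mulrC ler_pM ?frob_ge0.
have small i : lam i != 0 -> frob H <= `|lam i|.
  by move=> /gap; exact: le_trans.
(* Nonexpansiveness compares the true projection with [approx_pos], the exact projection of a matrix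
   at distance [O(|H|^2)]. *)
have := moreau_le (psd_proj_moreau (diag_mx L + H)) (approx_moreau sH small).
have := frobD (diag_mx Lp + dproj H - approx_pos H)
  (approx_neg H - (diag_mx Lp + dproj H - (diag_mx L + H))).
rewrite [X in X <= _ -> _](_ : _ = frob (diag_mx L + H - (approx_pos H - approx_neg H))).
  rewrite (frobC (_ + dproj H)) => h1 h2.
  rewrite -(subrKA (approx_pos H)); apply: le_trans (frobD _ _) _; lra.
congr frob; move: (diag_mx Lp + dproj H) (approx_pos H) (approx_neg H) (diag_mx L + H).
by move=> a b d e; apply/matrixP => i j; rewrite !mxE; ring.
Qed.

End Expansion.

(** * The directional derivative in block form *)

Section Selection.
Context {R : realType} {p q : nat} (f : 'I_q -> 'I_p).
Hypothesis f_inj : injective f.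

(** Column [k] is the unit vector at [f k]: conjugation embeds a [q] by [q] block, and conjugation
    by the transpose extracts it. *)
Definition selmx : 'M[R]_(p, q) := \matrix_(i, k) (i == f k)%:R.

Lemma selmx_compressE (X : 'M[R]_p) k l :
  (selmx^T *m X *m selmx) k l = X (f k) (f l).
Proof.
rewrite mxE (bigD1 (f l)) //= [selmx _ _]mxE eqxx mulr1 big1 ?addr0; last first.
  by move=> j /negbTE jl; rewrite [selmx _ _]mxE jl mulr0.
rewrite mxE (bigD1 (f k)) //= !mxE eqxx mul1r big1 ?addr0 // => i /negbTE ik.
by rewrite !mxE ik mul0r.
Qed.

Lemma selmx_isom : selmx^T *m selmx = 1%:M.
Proof.
rewrite -[selmx^T]mulmx1; apply/matrixP => k l.
by rewrite selmx_compressE !mxE (inj_eq f_inj).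
Qed.

Lemma selmx_expandE (M : 'M[R]_q) k l :
  (selmx *m M *m selmx^T) (f k) (f l) = M k l.
Proof.
rewrite -selmx_compressE !mulmxA selmx_isom mul1mx.
by rewrite -mulmxA selmx_isom mulmx1.
Qed.

Lemma mask_codomE (b : pred 'I_p) (X : 'M[R]_p) :
  (forall i, reflect (exists k, i = f k) (b i)) ->
  maskmx b X = selmx *m (selmx^T *m X *m selmx) *m selmx^T.
Proof.
move=> bf; apply/matrixP => i j; rewrite mxE.
have [/= bi|/= bi] := boolP (b i); last first.
  rewrite -!mulmxA mxE big1 // => k _; rewrite mxE.
  have /negbTE -> : i != f k by apply: contra bi => /eqP ->; apply/bf; exists k.
  by rewrite mul0r.
have [/= bj|/= bj] := boolP (b j); last first.
  rewrite mxE big1 // => k _; rewrite !mxE.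
  have /negbTE -> : j != f k by apply: contra bj => /eqP ->; apply/bf; exists k.
  by rewrite mulr0.
by have [[k ->] [l ->]] := (bf _ bi, bf _ bj); rewrite selmx_expandE selmx_compressE.
Qed.

End Selection.

(** If [i] is in [S], then [S] contains the [i + 1] indices up to [i]; otherwise [S] lies among the
    [i] indices before it. Cardinals decide. *)
Lemma in_initial_set (n : nat) (S : {set 'I_n}) :
  (forall i j : 'I_n, (i <= j)%N -> j \in S -> i \in S) ->
  forall i, (i \in S) = (i < #|S|)%N.
Proof.
move=> dS i.
have card_lt k (kn : (k <= n)%N) : #|[set j : 'I_n | (j < k)%N]| = k.
  have inj : injective (widen_ord kn) by move=> a b /(congr1 val)/= /val_inj.
  rewrite -[RHS]card_ord -(card_imset predT inj).
  apply: eq_card => j; rewrite inE; apply/idP/imsetP => [jk|[l _ ->]] /=.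
    by exists (Ordinal jk) => //; exact: val_inj.
  exact: ltn_ord.
apply/idP/idP => [iS|].
  rewrite -[X in (X <= _)%N](card_lt i.+1 (ltn_ord i)).
  by apply: subset_leq_card; apply/fintype.subsetP => j; rewrite inE ltnS => /dS; apply.
apply: contraLR => iS; rewrite -leqNgt -[X in (_ <= X)%N](card_lt i (ltnW (ltn_ord i))).
apply: subset_leq_card; apply/fintype.subsetP => j jS; rewrite inE ltnNge.
by apply: contra iS => /dS; apply.
Qed.

Lemma mxgetE (R : realType) (p : nat) (M : 'M[R]_p) (i j : 'I_p) :
  mxget M i j = M i j.
Proof. by rewrite /mxget !valK. Qed.

Section SortedSpectrum.
Context {R : realType} {n : nat} (lam : 'I_n -> R) (Q : 'M[R]_n).
Hypothesis lam_sorted : forall i j : 'I_n, (i <= j)%N -> lam j <= lam i.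

(** Sortedness converts the positional tests of [Dtil] into sign tests on the eigenvalues. *)
Lemma lt_npos (i : 'I_n) : (i < npos lam)%N = (0 < lam i).
Proof.
rewrite -in_initial_set ?inE // => j k jk; rewrite !inE => /lt_le_trans; apply.
exact: lam_sorted.
Qed.

Lemma lt_subn_nneg (i : 'I_n) : (i < n - nneg lam)%N = (0 <= lam i).
Proof.
have -> : (n - nneg lam)%N = #|~: [set i | lam i < 0]|.
  by rewrite [RHS]cardsCs finset.setCK card_ord.
rewrite -in_initial_set ?inE ?leNgt // => j k jk; rewrite !inE -!leNgt.
by move=> /le_trans; apply; exact: lam_sorted.
Qed.

Lemma npos_leq (i : 'I_n) : (npos lam <= i)%N = (lam i <= 0).
Proof. by rewrite leqNgt lt_npos leNgt. Qed.

Lemma subn_nneg_leq (i : 'I_n) : (n - nneg lam <= i)%N = (lam i < 0).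
Proof. by rewrite leqNgt lt_subn_nneg ltNge. Qed.

(** Ensures that the natural subtraction in the size of the beta block is not truncated. *)
Lemma nneg_le_subn_npos : (nneg lam <= n - npos lam)%N.
Proof.
rewrite (_ : (n - npos lam)%N = #|~: [set i | 0 < lam i]|).
  apply: subset_leq_card; apply/fintype.subsetP => i.
  by rewrite !inE -leNgt => /ltW.
by rewrite [RHS]cardsCs finset.setCK card_ord.
Qed.

Fact beta_index_lt (k : 'I_(n - npos lam - nneg lam)) : (npos lam + k < n)%N.
Proof. by have := ltn_ord k; lia. Qed.

Definition beta_index k : 'I_n := Ordinal (beta_index_lt k).

Lemma beta_index_inj : injective beta_index.
Proof. by move=> k l /(congr1 val)/= /addnI /val_inj. Qed.

Lemma beta_indexP i : reflect (exists k, i = beta_index k) (lam i == 0).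
Proof.
have le := nneg_le_subn_npos.
apply: (iffP idP) => [i0|[k ->]].
  have h1 : (npos lam <= i)%N by rewrite npos_leq (eqP i0).
  have h2 : (i < n - nneg lam)%N by rewrite lt_subn_nneg (eqP i0).
  have kn : (i - npos lam < n - npos lam - nneg lam)%N by lia.
  by exists (Ordinal kn); apply: val_inj; rewrite /= subnKC.
have kn := ltn_ord k.
by rewrite eq_le -npos_leq -lt_subn_nneg /=; apply/andP; split; lia.
Qed.

Local Notation J := (selmx (R := R) beta_index).

Lemma beta_blockE (H : 'M[R]_n) : beta_block lam Q H = J^T *m hatmx Q H *m J.
Proof.
apply/matrixP => k l; rewrite selmx_compressE mxE.
by rewrite -mxgetE.
Qed.

Lemma mask_zero_eigE (X : 'M[R]_n) :
  maskmx (fun i => lam i == 0) X = J *m (J^T *m X *m J) *m J^T.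
Proof. apply: mask_codomE; [exact: beta_index_inj | exact: beta_indexP]. Qed.

Lemma Dtil_dproj (H : 'M[R]_n) : symmx H ->
  Dtil lam Q H = Q *m dproj lam (hatmx Q H) *m Q^T.
Proof.
move=> sH; congr (_ *m _ *m _); set X := hatmx Q H.
have sX i j : X j i = X i j.
  suff tX : X^T = X by rewrite -{1}tX mxE.
  by rewrite /X /hatmx !trmx_mul trmxK sH mulmxA.
apply/matrixP => i j; rewrite [LHS]mxE [RHS]mxE [weighted _ _ _ _]mxE /weight.
rewrite (sX i j).
have P0 : ~~ ((lam i == 0) && (lam j == 0)) ->
    psd_proj (maskmx (fun i => lam i == 0) X) i j = 0.
  by move=> /negbTE h; rewrite -psd_proj_mask mxE h.
have PB : (lam i == 0) && (lam j == 0) ->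
    mxget (psd_proj (beta_block lam Q H)) (i - npos lam) (j - npos lam) =
    psd_proj (maskmx (fun i => lam i == 0) X) i j.
  move=> /andP[/beta_indexP[k ->] /beta_indexP[l ->]] /=.
  rewrite !addKn mxgetE beta_blockE mask_zero_eigE psd_proj_conj.
    by rewrite selmx_expandE //; exact: beta_index_inj.
  by apply: selmx_isom; exact: beta_index_inj.
move: (mxget _ _ _) (psd_proj (maskmx _ _) i j) (X i j) P0 PB => B P a P0 PB.
(* Every position test becomes a sign test, leaving a scalar identity in each of the nine sign
   cases. *)
have := (lt_npos i, npos_leq i, lt_subn_nneg i, subn_nneg_leq i).
have := (lt_npos j, npos_leq j, lt_subn_nneg j, subn_nneg_leq j).
move: (npos lam) (n - nneg lam)%N => r s hj hi; rewrite !(hi, hj) !leNgt.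
move: P0 PB; case: (sign_rules (lam i)) => [[[x0 rx]|[x0 rx]]|rx];
  case: (sign_rules (lam j)) => [[[y0 ry]|[y0 ry]]|ry];
  rewrite !(rx, ry, ltxx, eqxx, normr0, maxxx, addr0, add0r, sub0r, subr0) /= => P0 PB;
  first [have -> := P0 isT | have -> := PB isT];
  rewrite ?(mul0r, addr0, add0r) //; field; apply/eqP; lra.
Qed.

End SortedSpectrum.

(** * Orthogonal change of basis *)

Section OrthogonalChange.
Context {R : realType} {n : nat} (Q : 'M[R]_n).
Hypothesis QQ : Q^T *m Q = 1%:M.

Lemma hatmxK (X : 'M[R]_n) : Q *m hatmx Q X *m Q^T = X.
Proof.
have QQ' := mulmx1C QQ.
by rewrite /hatmx !mulmxA QQ' mul1mx -mulmxA QQ' mulmx1.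
Qed.

Lemma hatmx_conj (X : 'M[R]_n) : hatmx Q (Q *m X *m Q^T) = X.
Proof. by rewrite /hatmx !mulmxA QQ mul1mx -mulmxA QQ mulmx1. Qed.

Lemma frob_hatmx (X : 'M[R]_n) : frob (hatmx Q X) = frob X.
Proof. by rewrite -{2}(hatmxK X) frob_isom. Qed.

Lemma mxinner_hatmx (X Y : 'M[R]_n) : mxinner (hatmx Q X) (hatmx Q Y) = mxinner X Y.
Proof. by rewrite -{2}(hatmxK X) -{2}(hatmxK Y) mxinner_isom. Qed.

Lemma hatmxB (X Y : 'M[R]_n) : hatmx Q (X - Y) = hatmx Q X - hatmx Q Y.
Proof. by rewrite /hatmx mulmxBr mulmxBl. Qed.

Lemma hatmxZ a (X : 'M[R]_n) : hatmx Q (a *: X) = a *: hatmx Q X.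
Proof. by rewrite /hatmx -scalemxAr -scalemxAl. Qed.

Lemma symm_hatmx (X : 'M[R]_n) : symmx X -> symmx (hatmx Q X).
Proof. by move=> sX; rewrite /symmx /hatmx !trmx_mul trmxK sX mulmxA. Qed.

End OrthogonalChange.

(** * Strict contraction of [Mtil] under nondegeneracy *)

Section Contraction.
Context {R : realType} {n m : nat} (A : 'I_m -> 'M[R]_n).
Context (lam : 'I_n -> R) (Q : 'M[R]_n).
Hypothesis A_surj : forall v : 'cV[R]_m, exists X, symmx X /\ Aop A X = v.
Hypothesis QQ : Q^T *m Q = 1%:M.
Hypothesis lam_sorted : forall i j : 'I_n, (i <= j)%N -> lam j <= lam i.
Hypothesis primal_nondeg : forall W : 'M[R]_n, NX lam Q W ->
  (exists y : 'cV[R]_m, W = Aadj A y) -> W = 0.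
Hypothesis dual_nondeg : forall W : 'M[R]_n, NS lam Q W -> Aop A W = 0 -> W = 0.
Implicit Types H : 'M[R]_n.

Lemma symmB (X Y : 'M[R]_n) : symmx X -> symmx Y -> symmx (X - Y).
Proof. by move=> sX sY; rewrite /symmx linearB /= sX sY. Qed.

Lemma symmZ a (X : 'M[R]_n) : symmx X -> symmx (a *: X).
Proof. by move=> sX; rewrite /symmx linearZ /= sX. Qed.

Lemma weightC i j : weight lam i j = weight lam j i.
Proof. by rewrite /weight addrC [`|_| + _]addrC. Qed.

Lemma weight_eq1 i j : 0 < lam i -> 0 <= lam j -> weight lam i j = 1.
Proof.
move=> i0 j0; rewrite /weight gtr0_norm // ger0_norm // !max_l // ?ltW // divff //.
by rewrite gt_eqF // ltr_wpDr.
Qed.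

Lemma weight_eq0 i j : lam i <= 0 -> lam j <= 0 -> weight lam i j = 0.
Proof. by move=> i0 j0; rewrite /weight !max_r // addr0 mul0r. Qed.

Lemma symm_dproj H : symmx H -> symmx (dproj lam H).
Proof.
move=> sH; rewrite /symmx linearD /=; congr (_ + _); last first.
  by have [-> _] := psd_proj_psd (maskmx (fun i => lam i == 0) H).
by apply/matrixP => i j; rewrite !mxE weightC -{1}sH mxE.
Qed.

Lemma hat_Dtil H : symmx H -> hatmx Q (Dtil lam Q H) = dproj lam (hatmx Q H).
Proof. by move=> sH; rewrite Dtil_dproj // hatmx_conj. Qed.

Lemma symm_Dtil H : symmx H -> symmx (Dtil lam Q H).
Proof.
move=> sH; rewrite Dtil_dproj // /symmx !trmx_mul trmxK.
by rewrite (symm_dproj (symm_hatmx Q sH)) mulmxA.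
Qed.

Lemma DtilZ a H : 0 <= a -> symmx H -> Dtil lam Q (a *: H) = a *: Dtil lam Q H.
Proof.
move=> a0 sH; rewrite !Dtil_dproj //; last exact: symmZ.
by rewrite hatmxZ dprojZ // -scalemxAr -scalemxAl.
Qed.

Lemma Dtil_lipschitz H H' : symmx H -> symmx H' ->
  frob (Dtil lam Q H - Dtil lam Q H') <= 2 * frob (H - H').
Proof.
move=> sH sH'; rewrite !Dtil_dproj // -mulmxBl -mulmxBr frob_isom //.
by rewrite -(frob_hatmx QQ (H - H')) hatmxB dproj_lipschitz.
Qed.

Lemma MtilZ a H : 0 <= a -> symmx H -> Mtil A lam Q (a *: H) = a *: Mtil A lam Q H.
Proof.
move=> a0 sH; rewrite /Mtil /Pperp /Dtil_perp DtilZ // -scalerBr !PopZ.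
by rewrite -scalerBr -scalerDr.
Qed.

(** The [Pop] part of the difference contributes 1 + 2 and the [Pperp] part 2. The one-sided form is
    the one [argmax_exists] takes. *)
Lemma Mtil_lipschitz H H' : symmx H -> symmx H' ->
  frob (Mtil A lam Q H) - frob (Mtil A lam Q H') <= 5 * frob (H - H').
Proof.
move=> sH sH'; rewrite lerBlDr /Mtil /Pperp /Dtil_perp.
have := Dtil_lipschitz sH sH'.
move: (Dtil lam Q H) (Dtil lam Q H') => D D' DD'.
have -> : Pop A (H - D) + (D - Pop A D) =
    Pop A ((H - H') - (D - D')) + Pperp A (D - D') + (Pop A (H' - D') + (D' - Pop A D')).
  rewrite /Pperp !PopB.
  move: (Pop A H) (Pop A H') (Pop A D) (Pop A D') => a a' d d'.
  by apply/matrixP => i j; rewrite !mxE; ring.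
apply: le_trans (frobD _ _) _; rewrite lerD2r.
apply: le_trans (frobD _ _) _.
have := frob_Pop A_surj ((H - H') - (D - D')); have := frob_Pperp A_surj (D - D').
have := frobB (H - H') (D - D'); lra.
Qed.

(** Outside the zero block the entries multiply to [w x (1 - w) x]; inside it, the two parts are a
    Moreau pair and contribute nothing in total. *)
Lemma mxinner_Dtil_perp H : symmx H ->
  mxinner (Dtil lam Q H) (Dtil_perp lam Q H) =
  \sum_i \sum_j weight lam i j * (1 - weight lam i j) *
    (if (lam i == 0) && (lam j == 0) then 0 else hatmx Q H i j ^+ 2).
Proof.
move=> sH; rewrite /Dtil_perp -(mxinner_hatmx QQ) hatmxB hat_Dtil //.
move: (hatmx Q H) => X.
pose zer : pred 'I_n := fun i => lam i == 0.
set P := psd_proj (maskmx zer X).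
have oP : mxinner P (maskmx zer X - P) = 0.
  by rewrite mxinnerC; have [] := psd_proj_moreau (maskmx zer X).
have Pm : maskmx zer P = P by exact: psd_proj_mask.
rewrite /dproj -[LHS]subr0 -[X in _ - X = _]oP /mxinner -sumrB; apply: eq_bigr => i _.
rewrite -sumrB; apply: eq_bigr => j _.
have -> : (X - (weighted lam X + P)) i j = X i j - (weight lam i j * X i j + P i j).
  by rewrite !mxE.
have -> : (weighted lam X + P) i j = weight lam i j * X i j + P i j by rewrite !mxE.
have -> : (maskmx zer X - P) i j = maskmx zer X i j - P i j by rewrite !mxE.
rewrite [maskmx _ _ _ _]mxE -{}Pm [maskmx _ _ _ _]mxE /zer.
case: ifP => [/andP[/eqP i0 /eqP j0]|_]; last by ring.
rewrite /weight i0 j0 normr0 maxxx addr0 mul0r; ring.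
Qed.

Let block_term_ge0 (X : 'M[R]_n) i j : 0 <= weight lam i j * (1 - weight lam i j) *
  (if (lam i == 0) && (lam j == 0) then 0 else X i j ^+ 2).
Proof.
apply: mulr_ge0; first by rewrite mulr_ge0 ?weight_ge0 // subr_ge0 weight_le1.
by case: (_ && _) => //; exact: sqr_ge0.
Qed.

Lemma mxinner_Dtil_perp_ge0 H : symmx H ->
  0 <= mxinner (Dtil lam Q H) (Dtil_perp lam Q H).
Proof.
move=> sH; rewrite mxinner_Dtil_perp //.
by apply: sumr_ge0 => i _; apply: sumr_ge0 => j _.
Qed.

(** For eigenvalues of opposite strict signs [weight] lies strictly between 0 and 1, so a null sum
    of nonnegative terms forces the entry to vanish. *)
Lemma hatmx_alpha_gamma_eq0 H i j : symmx H ->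
  mxinner (Dtil lam Q H) (Dtil_perp lam Q H) = 0 ->
  0 < lam i -> lam j < 0 -> hatmx Q H i j = 0.
Proof.
move=> sH; rewrite mxinner_Dtil_perp // => /eqP.
rewrite psumr_eq0 => [/allP/(_ i (mem_index_enum i))/=|k _]; last exact: sumr_ge0.
rewrite psumr_eq0 => [/allP/(_ j (mem_index_enum j))/=|//] h i0 j0; move: h.
rewrite (gt_eqF i0) /= mulf_eq0 sqrf_eq0 => /orP[|/eqP//].
rewrite /weight.
rewrite gtr0_norm // ltr0_norm // max_l ?max_r ?ltW // addr0.
have d0 : lam i - lam j != 0 by apply/eqP; lra.
have -> : 1 - lam i / (lam i - lam j) = - lam j / (lam i - lam j) by field.
by rewrite !mulf_eq0 oppr_eq0 invr_eq0 (negbTE d0) (gt_eqF i0) (lt_eqF j0).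
Qed.

(** Expand the square of [Dtil + Dtil_perp] and split each part by Pythagoras along [Pop] and
    [Pperp]; [Mtil] keeps one component of each. *)
Lemma frob_Mtil_sqr H : symmx H ->
  frob H ^+ 2 = frob (Mtil A lam Q H) ^+ 2
    + 2 * mxinner (Dtil lam Q H) (Dtil_perp lam Q H)
    + frob (Pperp A (Dtil_perp lam Q H)) ^+ 2 + frob (Pop A (Dtil lam Q H)) ^+ 2.
Proof.
move=> sH; rewrite /Mtil frob_Pop_add_Pperp //.
have := frob_sqr_split A_surj (Dtil lam Q H).
have := frob_sqr_split A_surj (Dtil_perp lam Q H).
have : frob (Dtil_perp lam Q H + Dtil lam Q H) ^+ 2 = frob H ^+ 2 by rewrite subrK.
move: (Dtil_perp lam Q H) (Dtil lam Q H) => E D.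
rewrite [frob (E + D) ^+ 2]frob_sqr mxinnerDl !mxinnerDr (mxinnerC E D) -!frob_sqr.
by move=> <- -> ->; ring.
Qed.

Lemma frob_Mtil_le H : symmx H -> frob (Mtil A lam Q H) <= frob H.
Proof.
move=> sH; rewrite -(@ler_pXn2r _ 2) ?nnegrE ?frob_ge0 // (frob_Mtil_sqr sH).
by rewrite -!addrA lerDl !addr_ge0 ?sqr_ge0 // pmulr_rge0 // mxinner_Dtil_perp_ge0.
Qed.

(** Symmetry extends the vanishing from the alpha rows to the alpha columns; the surviving corner is
    the witness. *)
Lemma NX_of_support W : symmx W ->
  (forall i j, 0 < lam i -> hatmx Q W i j = 0) -> NX lam Q W.
Proof.
move=> sW W0; split => //; have sX := symm_hatmx Q sW.
exists (\matrix_(k, l) mxget (hatmx Q W) (npos lam + k) (npos lam + l)); split.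
  apply/matrixP => k l; rewrite !mxE /mxget.
  by case: insub => [i|]; case: insub => [j|] //; rewrite -{1}sX mxE.
apply/matrixP => i j; rewrite [RHS]mxE.
case: ifP => [/andP[ri rj]|].
  have hi : (i - npos lam < n - npos lam)%N by rewrite ltn_sub2r // (leq_ltn_trans ri).
  have hj : (j - npos lam < n - npos lam)%N by rewrite ltn_sub2r // (leq_ltn_trans ri).
  rewrite -[(i - _)%N]/(val (Ordinal hi)) -[(j - _)%N]/(val (Ordinal hj)) mxgetE mxE /=.
  by rewrite !subnKC // mxgetE.
move=> /negbT; rewrite negb_and -!ltnNge !lt_npos // => /orP[/W0 -> //|/W0 h].
by rewrite -sX mxE h.
Qed.

Lemma NS_of_support W : symmx W ->
  (forall i j, lam i < 0 -> hatmx Q W i j = 0) -> NS lam Q W.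
Proof.
move=> sW W0; split => //; have sX := symm_hatmx Q sW.
exists (\matrix_(k, l) mxget (hatmx Q W) k l); split.
  apply/matrixP => k l; rewrite !mxE /mxget.
  by case: insub => [i|]; case: insub => [j|] //; rewrite -{1}sX mxE.
apply/matrixP => i j; rewrite [RHS]mxE.
case: ifP => [/andP[hi hj]|].
  rewrite -[nat_of_ord i]/(val (Ordinal hi)) -[nat_of_ord j]/(val (Ordinal hj)) mxgetE mxE /=.
  by rewrite mxgetE.
move=> /negbT; rewrite negb_and -!leqNgt !subn_nneg_leq // => /orP[/W0 -> //|/W0 h].
by rewrite -sX mxE h.
Qed.

Lemma Mtil_norm_eq H : symmx H -> frob H <= frob (Mtil A lam Q H) -> H = 0.
Proof.
move=> sH; rewrite -(@ler_pXn2r _ 2) ?nnegrE ?frob_ge0 // (frob_Mtil_sqr sH) => le0.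
have zeros (a o p q : R) : a + 2 * o + p + q <= a -> 0 <= o -> 0 <= p -> 0 <= q ->
  [/\ o = 0, p = 0 & q = 0] by split; lra.
have [o0 /eqP + /eqP] :=
  zeros _ _ _ _ le0 (mxinner_Dtil_perp_ge0 sH) (sqr_ge0 _) (sqr_ge0 _).
rewrite !sqrf_eq0 => /eqP/frob_eq0 PE /eqP/frob_eq0 PD.
have sX := symm_hatmx Q sH.
have X0 := hatmx_alpha_gamma_eq0 sH o0.
have X0' i j : 0 < lam i -> lam j < 0 -> hatmx Q H j i = 0.
  by move=> i0 j0; rewrite -sX mxE X0.
have P0 i j : ~~ ((lam i == 0) && (lam j == 0)) ->
    psd_proj (maskmx (fun i => lam i == 0) (hatmx Q H)) i j = 0.
  by move=> /negbTE h; rewrite -psd_proj_mask mxE h.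
(* On alpha rows [weight] is 1 except against gamma, where [H] now vanishes. Since [Pperp] kills
   [Dtil_perp], it equals its own [Pop] and lies in the range. *)
have E0 : Dtil_perp lam Q H = 0.
  apply: primal_nondeg.
    apply: NX_of_support; first exact: symmB (symm_Dtil sH).
    move=> i j i0; rewrite hatmxB hat_Dtil //.
    move: (hatmx Q H) X0 P0 => X X0 P0; rewrite !mxE P0 ?(gt_eqF i0) // addr0.
    have [j0|j0] := leP 0 (lam j); first by rewrite weight_eq1 // mul1r subrr.
    by rewrite X0 // mulr0 subr0.
  exists (invmx (AAadj A) *m Aop A (Dtil_perp lam Q H)).
  by apply/eqP; rewrite -subr_eq0; apply/eqP.
(* On gamma rows [weight] is 0 except against alpha, where [H] vanishes. Since [Pop] kills [Dtil],
   so does [Aop]. *)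
have D0 : Dtil lam Q H = 0.
  apply: dual_nondeg.
    apply: NS_of_support; first exact: symm_Dtil.
    move=> i j i0; rewrite hat_Dtil //.
    move: (hatmx Q H) X0' P0 => X X0' P0; rewrite !mxE P0 ?(lt_eqF i0) // addr0.
    have [j0|j0] := ltP 0 (lam j); first by rewrite X0' // mulr0.
    by rewrite weight_eq0 ?mul0r // ltW.
  by rewrite -(Aop_Pop A_surj) PD /Aop; apply/matrixP => i j; rewrite !mxE mxinner0r.
by rewrite -(subrK (Dtil lam Q H) H) -/(Dtil_perp lam Q H) E0 D0 addr0.
Qed.

Let unit_norms : set R := [set t | exists H,
  [/\ symmx H, frob H = 1 & t = frob (Mtil A lam Q H)]]%classic.

(** Positive homogeneity reduces to unit [H]; the set is bounded above by 1, so [sup] is a genuine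
    upper bound. *)
Lemma Mtil_le_rho_ND H : symmx H -> frob (Mtil A lam Q H) <= rho_ND A lam Q * frob H.
Proof.
move=> sH; have [H0|H0] := eqVneq (frob H) 0.
  by rewrite H0 mulr0 -H0 frob_Mtil_le.
have Hp : 0 < frob H by rewrite lt_def H0 frob_ge0.
rewrite -ler_pdivrMr //; apply: ub_le_sup.
  by exists 1 => _ [H' [sH' H'1 ->]]; rewrite -H'1 frob_Mtil_le.
exists ((frob H)^-1 *: H); split; first exact: symmZ.
  by rewrite frobZ ger0_norm ?invr_ge0 ?frob_ge0 // mulVf.
by rewrite MtilZ ?invr_ge0 ?frob_ge0 // frobZ ger0_norm ?invr_ge0 ?frob_ge0 // mulrC.
Qed.

Lemma rho_ND_lt1 : rho_ND A lam Q < 1.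
Proof.
(* An empty unit sphere, as for [n = 0], gives [sup] its default value 0. *)
have [S0|/set0P S0] := eqVneq unit_norms set0.
  by rewrite /rho_ND -/unit_norms S0 sup0 ltr01.
pose S : set 'M[R]_n := [set H | symmx H /\ frob H = 1]%classic.
have [|||||H [sH H1] Hmax] :=
  @argmax_exists _ _ S (fun H => frob (Mtil A lam Q H)) 1 5.
- by have [_ [H [sH H1 _]]] := S0; exists H.
- by move=> H [_ ->].
- move=> X h; split.
    by apply: symm_limit => e /h[Y [sY _] XY]; exists Y.
  apply/eqP; rewrite eq_le; apply/andP; split; apply/ler_addgt0Pr => e /h[Y [_ Y1] XY].
    rewrite -(subrK Y X) -Y1 addrC; apply: le_trans (frobD _ _) _; lra.
  rewrite -Y1 -(subrK X Y) addrC; apply: le_trans (frobD _ _) _.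
  by rewrite frobC in XY; lra.
- by [].
- by move=> X Y [sX _] [sY _]; exact: Mtil_lipschitz.
have : frob (Mtil A lam Q H) < 1.
  rewrite -H1 ltNge; apply/negP => /(Mtil_norm_eq sH) H0.
  by move: H1; rewrite H0 frob0 => /eqP; rewrite eq_sym oner_eq0.
apply: le_lt_trans; apply: ge_sup => // _ [Y [sY Y1 ->]]; exact: Hmax.
Qed.

End Contraction.

(** * One ADMM step near the limit *)

Section AdmmStep.
Context {R : realType} {n m : nat} (A : 'I_m -> 'M[R]_n).
Hypothesis A_symm : forall i, symmx (A i).
Hypothesis A_surj : forall v : 'cV[R]_m, exists X, symmx X /\ Aop A X = v.

Lemma symm_Pop X : symmx (Pop A X).
Proof. exact: symm_Aadj. Qed.

Lemma symm_admm_step b C sigma Z : symmx C -> symmx Z ->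
  symmx (admm_step A b C sigma Z).
Proof.
move=> sC sZ; have sD (X Y : 'M[R]_n) : symmx X -> symmx Y -> symmx (X + Y).
  by move=> sX sY; rewrite /symmx linearD /= sX sY.
have [sP _] := psd_proj_psd Z.
apply: symmB; last exact: symmZ.
apply: (sD); last by apply: symmZ; exact: symm_Pop.
apply: (sD); last exact: symm_Aadj.
by apply: (sD) => //; exact: symm_Pop.
Qed.

(** Substituting [b = Aop A X] and [C = Aadj A y + S] cancels the constant terms. The error [E]
    enters twice, since the step uses the projection both inside and outside [Pop]. *)
Lemma admm_step_expansion b C sigma X y S (H D E Z : 'M[R]_n) :
  KKT A b C X y S -> Z = X - sigma *: S + H -> psd_proj Z = X + D + E ->
  admm_step A b C sigma Z - (X - sigma *: S) =
  Pop A (H - D) + Pperp A D + (E - 2 *: Pop A E).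
Proof.
move=> [_ <- _ <- _] ZE PE; rewrite /admm_step PE ZE -/(Pop A X) /Pperp.
rewrite !(PopD, PopN, PopZ, Pop_Aadj) //.
move: (Pop A X) (Pop A S) (Pop A H) (Pop A D) (Pop A E) (Aadj A y) => a b' c d e f.
by apply/matrixP => i j; rewrite !mxE; ring.
Qed.

End AdmmStep.

Theorem theorem5 (R : realType) (n m : nat)
  (C : 'M[R]_n) (A : 'I_m -> 'M[R]_n) (b : 'cV[R]_m) (sigma : R)
  (Z : nat -> 'M[R]_n)
  (Xs : 'M[R]_n) (ys : 'cV[R]_m) (Ss : 'M[R]_n)
  (Q : 'M[R]_n) (lam : 'I_n -> R) :
  symmx C ->
  (forall i, symmx (A i)) ->
  (* A : S^n -> R^m is surjective *)
  (forall v : 'cV[R]_m, exists X : 'M[R]_n, symmx X /\ Aop A X = v) ->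
  0 < sigma ->
  (* the ADMM iterates *)
  symmx (Z 0%N) ->
  (forall k, Z k.+1 = admm_step A b C sigma (Z k)) ->
  (* KKT point and Z_* = X_* - sigma S_* is the limit of Z^(k) *)
  KKT A b C Xs ys Ss ->
  (forall eps : R, 0 < eps -> exists N : nat, forall k : nat, (N <= k)%N ->
     frob (Z k - (Xs - sigma *: Ss)) < eps) ->
  (* eigendecomposition of Z_* *)
  Q^T *m Q = 1%:M ->
  (forall i j : 'I_n, (i <= j)%N -> lam j <= lam i) ->
  Xs - sigma *: Ss = Q *m diag_mx (\row_i lam i) *m Q^T ->
  Xs = Q *m diag_mx (\row_i Num.max (lam i) 0) *m Q^T ->
  sigma *: Ss = Q *m diag_mx (\row_i (- Num.min (lam i) 0)) *m Q^T ->
  (* primal nondegeneracy: N_X cap range(A adjoint) = {0} *)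
  (forall W : 'M[R]_n, NX lam Q W -> (exists y : 'cV[R]_m, W = Aadj A y) ->
     W = 0) ->
  (* dual nondegeneracy: N_S cap ker(A) = {0} *)
  (forall W : 'M[R]_n, NS lam Q W -> Aop A W = 0 -> W = 0) ->
  rho_ND A lam Q < 1 /\
  forall rho : R, rho_ND A lam Q < rho -> rho < 1 ->
    exists kbar : nat, forall k : nat, (kbar <= k)%N ->
      frob (Z k.+1 - (Xs - sigma *: Ss)) <= rho * frob (Z k - (Xs - sigma *: Ss)).
Proof.
move=> sC sA surj sigma0 sZ0 Zrec kkt Zlim QQ sorted Zs_eq Xs_eq _ pnd dnd.
have lt1 := rho_ND_lt1 surj QQ sorted pnd dnd.
split=> // rho rho_gt _.
have sZs : symmx (Xs - sigma *: Ss).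
  by have [[sX _] _ [sS _] _ _] := kkt; apply: symmB => //; exact: symmZ.
have sZ k : symmx (Z k) by elim: k => // k IH; rewrite Zrec; exact: symm_admm_step.
have [c [delta [c0 delta0 expansion]]] := psd_proj_expansion lam.
set Zs := Xs - sigma *: Ss in Zs_eq sZs Zlim *.
(* Within [eps] the expansion is valid and the error [3 c |H|^2] fits into [(rho - rho_ND) |H|]; the
   [+ 1] keeps the divisor positive when [c = 0]. *)
pose eps := Num.min delta ((rho - rho_ND A lam Q) / (3 * c + 1)).
have c1 : 0 < 3 * c + 1 by lra.
have eps0 : 0 < eps by rewrite lt_min delta0 divr_gt0 // subr_gt0.
have [N ZN] := Zlim _ eps0; exists N => k /ZN.
set H := Z k - Zs; rewrite lt_min => /andP[/ltW Hdelta /ltW Hrho].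
have sH : symmx H by exact: symmB.
pose D := Dtil lam Q H; pose E := psd_proj (Z k) - (Xs + D).
have Ebound : frob E <= c * frob H ^+ 2.
  (* In the eigenbasis [E] is exactly the remainder bounded by [psd_proj_expansion]. *)
  have -> : E = Q *m (psd_proj (diag_mx (\row_i lam i) + hatmx Q H)
      - (diag_mx (\row_i Num.max (lam i) 0) + dproj lam (hatmx Q H))) *m Q^T.
    have := Dtil_dproj Q sorted sH; rewrite -/D; move: (dproj _ _) => W DW.
    rewrite mulmxBr mulmxBl -psd_proj_conj // !mulmxDr !mulmxDl hatmxK //.
    by rewrite -Zs_eq -Xs_eq -DW subrKC.
  rewrite frob_isom // -(frob_hatmx QQ H); apply: expansion.
    exact: symm_hatmx.
  by rewrite frob_hatmx.
have Zk : Z k = Zs + H by rewrite /H subrKC.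
have Pk : psd_proj (Z k) = Xs + D + E by rewrite /E subrKC.
rewrite Zrec (admm_step_expansion surj kkt Zk Pk).
apply: le_trans (frobD _ _) _.
have -> : Pop A (H - D) + Pperp A D = Mtil A lam Q H by [].
have M_le := Mtil_le_rho_ND surj QQ sorted sH.
have R_le : frob (E - 2 *: Pop A E) <= 3 * frob E.
  apply: le_trans (frobB _ _) _; rewrite frobZ ger0_norm //.
  have := frob_Pop surj E; lra.
have small : 3 * (c * frob H ^+ 2) <= (rho - rho_ND A lam Q) * frob H.
  rewrite expr2 !mulrA ler_wpM2r ?frob_ge0 //.
  move: Hrho; rewrite ler_pdivlMr //; have := frob_ge0 H.
  move: (frob H) => h h0; lra.
move: M_le R_le small Ebound.
move: (frob (Mtil _ _ _ _)) (frob (E - _)) (frob E) (frob H) (rho_ND _ _ _) => *; lra.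
Qed.
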